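(* Let $G$ be a compact Lie group acting smoothly on a closed smooth manifold $M$. If $f\in C^\infty(M)$ is a stable $G$-Morse-Bott function, then for every critical orbit $S$ of $f$, the negative normal bundle $\mathcal{N}^-(S)$ with respect to any $G$-invariant Riemannian metric on $M$ is a trivial vector bundle over $S$.
   Context: For a critical point $p$ of a smooth function $f$, $\mathrm{Hess}_f(p)(v,w)=V(Wf)(p)$ for vector fields $V,W$ extending $v,w\in T_pM$; $\ker(\mathrm{Hess}_f(p))=\{v : \mathrm{Hess}_f(p)(v,w)=0\ \forall w\}$. Morse-Bott: $f$ is Morse-Bott if its critical set $\mathrm{Crit}(f)$ is a disjoint union of connected submanifolds such that for each connected component $S$ and any $p\in S$, $T_pS=\ker(\mathrm{Hess}_f(p))$. $G$-Morse-Bott: a $G$-invariant smooth function $f$ is $G$-Morse-Bott if it is Morse-Bott and each connected component $S$ of $\mathrm{Crit}(f)$ satisfies $T_pS=T_p(G\cdot p)$ for any $p\in S$. A critical orbit is an orbit $G\cdot p$ consisting of critical points of $f$. Slice decomposition: for a critical point $p$ of $f$, let $H=\mathrm{stab}(p)$ and $N_p=T_pM/T_p(G\cdot p)$. The group $H$ acts linearly on $N_p$, and $N_p=N_p'\oplus N_p''$, where $N_p'$ is the subspace of vectors fixed by $H$ and $N_p''$ is the subspace of vectors $v$ with $\int_H h\cdot v\,d\mu_h=0$ for the Haar measure $\mu$ on $H$. $\mathrm{Hess}_f(p)$ descends to $N_p$. Stable: a connected component $S$ of $\mathrm{Crit}(f)$ is stable if $\mathrm{Hess}_f(p)$ is positive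 definite on $N_p''$ for some $p\in S$. $f$ is stable if all components of $\mathrm{Crit}(f)$ are stable. A stable $G$-Morse-Bott function is a $G$-Morse-Bott function that is stable. Negative normal bundle: given a $G$-invariant Riemannian metric $g$, identify $N_p$ with the orthogonal complement $T_p(G\cdot p)^\perp$, with induced inner product $g_p$, and let $A_p:N_p\to N_p$ be the self-adjoint operator with $\mathrm{Hess}_f(p)(v,w)=g_p(A_pv,w)$. Let $N_p^-\subseteq N_p$ be the sum of the eigenspaces of $A_p$ with negative eigenvalues. For a critical orbit $S$, the negative normal bundle $\mathcal{N}^-(S)$ is the vector bundle over $S$ with fiber $N_p^-$ at $p\in S$. *)

(* Defs.v *)
From HB Require Import structures.
From mathcomp Require Import all_boot all_order all_algebra.
From mathcomp Require Import all_classical all_reals all_analysis.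

Set Implicit Arguments.
Unset Strict Implicit.
Unset Printing Implicit Defensive.

Import Order.TTheory GRing.Theory Num.Theory.
Import numFieldNormedType.Exports.

Local Open Scope classical_set_scope.
Local Open Scope ring_scope.

Section SmoothCalculus.
Context {R : realType}.

(* [k_differentiable k U f] is meant for open [U]. *)
Fixpoint k_differentiable {V W : normedModType R} (k : nat) (U : set V)
    (f : V -> W) : Prop :=
  if k is k'.+1 then
    (forall x, U x -> differentiable f x) /\
    (forall v, k_differentiable k' U ('D_v f))
  else True.

Definition smooth_on {V W : normedModType R} (U : set V) (f : V -> W) : Prop :=
  forall k, k_differentiable k U f.

End SmoothCalculus.

(* Smooth manifolds.  An atlas is given as a family of charts indexed by the
   points, the chart [A p] being one around [p]; the smooth structure is the one
   generated by the family. *)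
Record chart (R : realType) (M : topologicalType) (n : nat) := Chart {
  dom : set M ;
  coord :> M -> 'rV[R]_n ;
  param : 'rV[R]_n -> M
}.

Definition atlas (R : realType) (M : topologicalType) (n : nat) :=
  M -> chart R M n.

Section Manifolds.
Context {R : realType}.

(* [c] is a homeomorphism from the open set [dom c] onto an open subset of R^n,
   with inverse [param c]. *)
Definition is_chart (M : topologicalType) n (c : chart R M n) : Prop :=
  [/\ open (dom c),
      open (c @` dom c),
      {in dom c, cancel c (param c)},
      {in dom c, continuous c} &
      {in c @` dom c, continuous (param c)}].

Definition smooth_transition (M : topologicalType) n (c d : chart R M n) : Prop :=
  smooth_on (c @` (dom c `&` dom d)) (d \o param c).

Definition smooth_manifold (M : topologicalType) n (A : atlas R M n) : Prop :=
  [/\ hausdorff_space M,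
      @second_countable M,
      forall p, is_chart (A p) /\ dom (A p) p &
      forall p q, smooth_transition (A p) (A q)].

Definition prod_atlas (M N : topologicalType) m n
    (A : atlas R M m) (B : atlas R N n) : atlas R (M * N)%type (m + n) :=
  fun z => {|
    dom := dom (A z.1) `*` dom (B z.2) ;
    coord := fun y => row_mx (A z.1 y.1) (B z.2 y.2) ;
    param := fun x => (param (A z.1) (lsubmx x), param (B z.2) (rsubmx x))
  |}.

Definition smooth_map (M N : topologicalType) m n
    (A : atlas R M m) (B : atlas R N n) (F : M -> N) : Prop :=
  continuous F /\
  forall p q, smooth_on (A p @` (dom (A p) `&` F @^-1` dom (B q)))
                        (B q \o F \o param (A p)).

Definition smooth_function (M : topologicalType) n (A : atlas R M n)
    (f : M -> R) : Prop :=
  forall p, smooth_on (A p @` dom (A p)) (f \o param (A p)).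

(* A tangent vector at [p] is represented by its components in the chart [A p],
   so that every T_pM is 'rV_n.  [chart_change c d q] converts the components
   of a tangent vector at [q] from the chart [c] to the chart [d]. *)
Definition chart_change (M : topologicalType) n (c d : chart R M n) (q : M)
    (v : 'rV[R]_n) : 'rV[R]_n := 'd (d \o param c) (c q) v.

Definition tangent_map (M N : topologicalType) m n
    (A : atlas R M m) (B : atlas R N n) (F : M -> N) (p : M)
    (v : 'rV[R]_m) : 'rV[R]_n :=
  'd (B (F p) \o F \o param (A p)) (A p p) v.

(* The derivative Vf of the function [f] along the vector field [V]. *)
Definition lie_derivative (M : topologicalType) n (A : atlas R M n)
    (V : M -> 'rV[R]_n) (f : M -> R) : M -> R :=
  fun q => 'd (f \o param (A q)) (A q q) (V q).

Definition critical_set (M : topologicalType) n (A : atlas R M n)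
    (f : M -> R) : set M :=
  [set p | forall v, 'd (f \o param (A p)) (A p p) v = 0].

(* [X] is smooth along the subset [S]: locally, in charts, it is the restriction
   to [S] of a smooth map defined on an open set. *)
Definition smooth_field_along (M : topologicalType) n (A : atlas R M n)
    (S : set M) (X : M -> 'rV[R]_n) : Prop :=
  forall p, S p -> exists (U : set 'rV[R]_n) (Y : 'rV[R]_n -> 'rV[R]_n),
    [/\ open U, U (A p p), smooth_on U Y &
        forall q, S q -> dom (A p) q -> U (A p q) ->
          chart_change (A q) (A p) q (X q) = Y (A p q)].

(* The vector field on [dom (A p)] extending [v] with constant components in
   the chart [A p]. *)
Definition constant_field (M : topologicalType) n (A : atlas R M n) (p : M)
    (v : 'rV[R]_n) : M -> 'rV[R]_n :=
  fun q => chart_change (A p) (A q) q v.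

(* V(Wf)(p) for a particular choice of extensions V, W of v, w; at a critical
   point any other choice gives the same value, see [hessianE] below. *)
Definition hessian (M : topologicalType) n (A : atlas R M n) (f : M -> R)
    (p : M) (v w : 'rV[R]_n) : R :=
  lie_derivative A (constant_field A p v)
    (lie_derivative A (constant_field A p w) f) p.

Definition hessian_kernel (M : topologicalType) n (A : atlas R M n)
    (f : M -> R) (p : M) : set 'rV[R]_n :=
  [set v | forall w, hessian A f p v w = 0].

(* Embedded submanifolds, by slice charts of the smooth structure. *)
Definition submanifold (M : topologicalType) n (A : atlas R M n)
    (S : set M) : Prop :=
  exists k : nat, forall p, S p -> exists c : chart R M n,
    [/\ is_chart c, dom c p,
        forall q, smooth_transition c (A q) /\ smooth_transition (A q) c &
        forall q, dom c q ->
          (S q <-> forall i : 'I_n, (k <= i)%N -> c q ord0 i = 0)].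

(* Velocities at [p] of the smooth curves of [M] contained in [S]. *)
Definition tangent_space (M : topologicalType) n (A : atlas R M n)
    (S : set M) (p : M) : set 'rV[R]_n :=
  [set v | exists (c : R -> M) (e : R),
    [/\ 0 < e, c 0 = p,
        forall t, `|t| < e -> S (c t) /\ dom (A p) (c t),
        smooth_on [set t : R | `|t| < e] (A p \o c) &
        'D_1 (A p \o c) 0 = v]].

Definition morse_bott (M : topologicalType) n (A : atlas R M n)
    (f : M -> R) : Prop :=
  forall p, critical_set A f p ->
    let S := connected_component (critical_set A f) p in
    submanifold A S /\
    forall q, S q -> tangent_space A S q = hessian_kernel A f q.

Definition riemannian_metric (M : topologicalType) n (A : atlas R M n)
    (g : M -> 'rV[R]_n -> 'rV[R]_n -> R) : Prop :=
  [/\ forall p u, linear (g p u : 'rV[R]_n -> R^o),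
      forall p u v, g p u v = g p v u,
      forall p v, v != 0 -> 0 < g p v v &
      forall p v w, smooth_on (A p @` dom (A p))
        ((fun q => g q (constant_field A p v q) (constant_field A p w q))
           \o param (A p) : 'rV[R]_n -> R^o)].

(* A smooth trivialization S x R^k -> E, linear and bijective on the fibres,
   of the family of subspaces [E q] of T_qM, q in [S].  Joint smoothness follows
   from the smoothness for fixed [x] by linearity in [x], and a bijective smooth
   bundle map over [S] has a smooth inverse. *)
Definition trivial_vector_bundle (M : topologicalType) n (A : atlas R M n)
    (S : set M) (E : M -> set 'rV[R]_n) : Prop :=
  exists (k : nat) (Phi : M -> 'rV[R]_k -> 'rV[R]_n),
    (forall q, S q ->
       [/\ linear (Phi q), injective (Phi q) & range (Phi q) = E q]) /\
    (forall x, smooth_field_along A S (fun q => Phi q x)).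

End Manifolds.

#[short(type="groupTopologicalType")]
HB.structure Definition GroupTopological := {G of Topological G & Group G}.

(* Measurable types must be pointed; we point a group at its unit. *)
Definition pointed_group (G : groupTopologicalType) : Type := G.
HB.instance Definition _ (G : groupTopologicalType) :=
  Choice.on (pointed_group G).
HB.instance Definition _ (G : groupTopologicalType) :=
  isPointed.Build (pointed_group G) (1%g : G).

Notation borel G :=
  (g_sigma_algebraType (@open G : set (set (pointed_group G)))).

Section Actions.
Context {R : realType}.

Definition lie_group (G : groupTopologicalType) m (A : atlas R G m) : Prop :=
  [/\ smooth_manifold A,
      smooth_map (prod_atlas A A) A (fun z : G * G => z.1 * z.2)%g &
      smooth_map A A (fun a : G => a^-1)%g].

Context (G : groupTopologicalType) (m : nat) (A : atlas R G m).
Context (M : topologicalType) (n : nat) (B : atlas R M n).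
Context (act : G -> M -> M).

Definition smooth_action : Prop :=
  [/\ forall p, act 1%g p = p,
      forall a b p, act (a * b)%g p = act a (act b p) &
      smooth_map (prod_atlas A B) B (fun z : G * M => act z.1 z.2)].

Definition orbit (p : M) : set M := [set act a p | a in [set: G]].

Definition stabilizer (p : M) : set G := [set a | act a p = p].

(* T_p(G.p): the image of T_1G under the differential of a |-> act a p. *)
Definition orbit_tangent (p : M) : set 'rV[R]_n :=
  range (tangent_map A B (fun a => act a p) 1%g).

Definition invariant_function (f : M -> R) : Prop :=
  forall a p, f (act a p) = f p.

Definition invariant_metric (g : M -> 'rV[R]_n -> 'rV[R]_n -> R) : Prop :=
  forall a p v w,
    g (act a p) (tangent_map B B (act a) p v) (tangent_map B B (act a) p w) =
    g p v w.

Definition G_morse_bott (f : M -> R) : Prop :=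
  [/\ smooth_function B f, invariant_function f, morse_bott B f &
      forall p, critical_set B f p ->
        let S := connected_component (critical_set B f) p in
        forall q, S q -> tangent_space B S q = orbit_tangent q].

Definition critical_orbit (f : M -> R) (S : set M) : Prop :=
  S `<=` critical_set B f /\ exists p, S = orbit p.

(* The (normalized) Haar measure of a closed subgroup [H], seen as a Borel
   measure on [G] carried by [H]. *)
Definition haar_measure (H : set G) (mu : probability (borel G) R) : Prop :=
  mu H = 1%E /\
  forall (h : G) (E : set (borel G)), H h -> measurable E ->
    mu [set (h * a)%g | a in (E : set G)] = mu E.

(* Integral over the stabilizer of [p] of h.v, computed componentwise. *)
Definition average (mu : probability (borel G) R) (p : M) (v : 'rV[R]_n) :
    'rV[R]_n :=
  \row_i Rintegral mu (stabilizer p)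
    (fun h => tangent_map B B (act h) p v ord0 i).

(* The inverse image of N_p'' under the projection of T_pM onto
   N_p = T_pM / T_p(G.p). *)
Definition N'' (mu : probability (borel G) R) (p : M) : set 'rV[R]_n :=
  [set v | orbit_tangent p (average mu p v)].

(* A class in N_p is nonzero when its representatives are not in T_p(G.p). *)
Definition positive_definite_on_N'' (f : M -> R) (p : M) : Prop :=
  exists2 mu, haar_measure (stabilizer p) mu &
    forall v, N'' mu p v -> ~ orbit_tangent p v -> 0 < hessian B f p v v.

Definition stable (f : M -> R) : Prop :=
  forall p, critical_set B f p ->
    exists2 q, connected_component (critical_set B f) p q &
               positive_definite_on_N'' f q.

Section NegativeNormalBundle.
Context (g : M -> 'rV[R]_n -> 'rV[R]_n -> R) (f : M -> R).

(* N_p identified with the orthogonal complement of T_p(G.p). *)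
Definition normal_space (p : M) : set 'rV[R]_n :=
  [set v | forall u, orbit_tangent p u -> g p v u = 0].

(* The operator A_p of N_p representing the Hessian. *)
Definition hessian_operator (p : M) (v : 'rV[R]_n) : 'rV[R]_n :=
  xget 0 [set u | normal_space p u /\
    forall w, normal_space p w -> hessian B f p v w = g p u w].

Definition negative_normal_space (p : M) : set 'rV[R]_n :=
  [set v | exists2 s : seq 'rV[R]_n,
    (forall u, u \in s -> normal_space p u /\
       exists2 l : R, l < 0 & hessian_operator p u = l *: u) &
    v = \sum_(u <- s) u].

End NegativeNormalBundle.

End Actions.

Lemma near_eq_is_diff (R : numFieldType) (V W : normedModType R)
    (f g : V -> W) (x : V) :
  {near x, f =1 g} -> differentiable f x -> is_diff x g ('d f x).
Proof.
move=> fg /diff_locallyP[dfc dfx].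
have gx : g x = f x by rewrite (nbhs_singleton fg).
have dgx : g \o shift x = cst (g x) + 'd f x +o_ 0 id.
  apply/eqaddoP => e e0; move/eqaddoP: dfx => /(_ e e0).
  have fg0 : \forall h \near 0, f (h + x) = g (h + x).
    by rewrite (near_shift x) /= sub0r; near=> y; rewrite /= subrK; near: y.
  apply: filter_app; near=> h; rewrite /= !fctE /= gx.
  by have -> : f (h + x) = g (h + x) by near: h.
apply: DiffDef; last exact: diff_unique.
by apply/diff_locallyP; rewrite (diff_unique dfc dgx).
Unshelve. all: by end_near. Qed.

Lemma near_eq_diff (R : numFieldType) (V W : normedModType R)
    (f g : V -> W) (x v : V) :
  {near x, f =1 g} -> differentiable f x -> 'd g x v = 'd f x v.
Proof. by move=> fg df; have [_ ->] := near_eq_is_diff fg df. Qed.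

Lemma diff_compE (R : numFieldType) (U V W : normedModType R)
    (f : U -> V) (g : V -> W) (x : U) (y : V) (u : U) :
  f x = y -> differentiable f x -> differentiable g y ->
  'd (g \o f) x u = 'd g y ('d f x u).
Proof. by move=> <- df dg; rewrite diff_comp. Qed.

Lemma is_diff_bigsum (R : numFieldType) (V W : normedModType R) (I : Type)
    (s : seq I) (P dP : I -> V -> W) (x : V) :
  (forall i, is_diff x (P i) (dP i)) ->
  is_diff x (\sum_(i <- s) P i) (\sum_(i <- s) dP i).
Proof.
move=> dPi; elim: s => [|i s IH].
  by rewrite !big_nil; exact: is_diff_cst.
by rewrite !big_cons; exact: is_diffD.
Qed.

Section HessianWellDefined.
Context {R : realType} (M : topologicalType) (n : nat) (A : atlas R M n).
Hypothesis mA : smooth_manifold A.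


Lemma smooth_on_diff (V W : normedModType R) (U : set V) (f : V -> W) x :
  smooth_on U f -> U x -> differentiable f x.
Proof. move=> sf Ux. have [d _] := sf 1%N. exact: d. Qed.

Lemma smooth_on_derive (V W : normedModType R) (U : set V) (f : V -> W) v :
  smooth_on U f -> smooth_on U ('D_v f).
Proof. by move=> sf k; have [_ h] := sf k.+1; exact: h. Qed.

Lemma near_chart_overlap (a b q : M) : dom (A a) q -> dom (A b) q ->
  \forall x \near A a q, (A a @` (dom (A a) `&` dom (A b))) x.
Proof.
case: mA => _ _ cA _ aq bq.
have [[oa oi aK _ ci] _] := cA a; have [[ob _ _ _ _] _] := cA b.
have /ci : A a q \in A a @` dom (A a) by apply/mem_set; exists q.
rewrite /continuous_at aK ?inE// => cq.
have i1 : \forall x \near A a q, (A a @` dom (A a)) x.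
  by apply: open_nbhs_nbhs; split => //; exists q.
have i2 : \forall x \near A a q, dom (A b) (param (A a) x).
  exact: cq _ (open_nbhs_nbhs (conj ob bq)).
near=> x.
have [y ay yx] : (A a @` dom (A a)) x by near: x.
have : dom (A b) (param (A a) x) by near: x.
by rewrite -yx aK ?inE// => byy; exists y.
Unshelve. all: by end_near. Qed.

Lemma chart_change_diff (a b q : M) : dom (A a) q -> dom (A b) q ->
  differentiable (A b \o param (A a)) (A a q).
Proof.
case: mA => _ _ _ tA aq bq.
by apply: smooth_on_diff (tA a b) _; exists q.
Qed.

Lemma chart_changeK (a b q : M) : dom (A a) q -> dom (A b) q ->
  cancel (chart_change (A a) (A b) q) (chart_change (A b) (A a) q).
Proof.
move=> aq bq v; case: (mA) => _ _ cA _.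
have [[_ _ aK _ _] _] := cA a; have [[_ _ bK _ _] _] := cA b.
have E : (A b \o param (A a)) (A a q) = A b q by rewrite /= aK ?inE.
rewrite /chart_change.
rewrite -(diff_compE v E (chart_change_diff aq bq) (chart_change_diff bq aq)).
rewrite (@near_eq_diff _ _ _ id); first by rewrite diff_val.
  near=> x.
  have [y [ay by_] <-] : (A a @` (dom (A a) `&` dom (A b))) x.
    by near: x; exact: near_chart_overlap.
  by rewrite /= aK ?inE// bK ?inE.
exact: ex_diff.
Unshelve. all: by end_near. Qed.

Lemma chart_changexx (a q : M) v : dom (A a) q ->
  chart_change (A a) (A a) q v = v.
Proof.
move=> aq; case: (mA) => _ _ cA _; have [[_ _ aK _ _] _] := cA a.
rewrite /chart_change (@near_eq_diff _ _ _ id); first by rewrite diff_val.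
  near=> x.
  have [y [ay _] <-] : (A a @` (dom (A a) `&` dom (A a))) x.
    by near: x; exact: near_chart_overlap.
  by rewrite /= aK ?inE.
exact: ex_diff.
Unshelve. all: by end_near. Qed.

Lemma smooth_on_cst (V W : normedModType R) (U : set V) (a : W) :
  smooth_on U (cst a).
Proof.
move=> k; elim: k a => [//|k IH] a; split=> [x _|v]; first exact: ex_diff.
have -> : 'D_v (cst a) = cst 0 :> (V -> W) by apply/funext => x; exact: derive_cst.
exact: IH.
Qed.

Lemma diff_diff (U : set 'rV[R]_n) (F : 'rV[R]_n -> R)
    (Y : 'rV[R]_n -> 'rV[R]_n) (x v : 'rV[R]_n) :
  open U -> U x -> smooth_on U F -> differentiable Y x ->
  (forall u, 'd F x u = 0) ->
  differentiable (fun y => 'd F y (Y y)) x /\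
  'd (fun y => 'd F y (Y y)) x v =
  \sum_(i < n) Y x ord0 i * 'd ('D_(delta_mx ord0 i) F) x v.
Proof.
move=> oU Ux sF dY crF.
pose P i := (fun y => Y y ord0 i) * ('D_(delta_mx ord0 i) F).
pose dP i := Y x ord0 i *: ('d ('D_(delta_mx ord0 i) F) x : _ -> _).
have dPi i : is_diff x (P i) (dP i).
  have dYi : differentiable (fun y => Y y ord0 i) x.
    by apply: (differentiable_comp (g := fun M : 'rV[R]_n => M ord0 i));
      last exact: differentiable_coord.
  have dDi : differentiable ('D_(delta_mx ord0 i) F) x.
    exact: smooth_on_diff (smooth_on_derive _ sF) Ux.
  have := is_diffM (differentiableP dYi) (differentiableP dDi).
  by rewrite deriveE ?crF ?scale0r ?addr0//; exact: smooth_on_diff sF Ux.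
have dS := is_diff_bigsum (index_enum 'I_n) dPi.
have [||dd dE] := @near_eq_is_diff _ _ _ (\sum_i P i)
  (fun y => 'd F y (Y y)) x; last 2 first.
- exact: ex_diff.
- by split => //; rewrite dE diff_val fct_sumE; apply: eq_bigr => i _.
near=> y.
have Uy : U y by near: y; exact: open_nbhs_nbhs.
have dFy := smooth_on_diff sF Uy.
rewrite fct_sumE [in RHS](row_sum_delta (Y y)) linear_sum.
apply: eq_bigr => i _.
by rewrite linearZ /P /= /GRing.mul /= deriveE.
Unshelve. all: by end_near. Qed.

Variable f : M -> R.
Hypothesis sf : smooth_function A f.

Lemma diff_chart (p q : M) v : dom (A p) q ->
  'd (f \o param (A q)) (A q q) v =
  'd (f \o param (A p)) (A p q) (chart_change (A q) (A p) q v).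
Proof.
move=> pq; case: (mA) => _ _ cA _.
have [[_ _ pK _ _] _] := cA p; have [[_ _ qK _ _] qq] := cA q.
have E : (A p \o param (A q)) (A q q) = A p q by rewrite /= qK ?inE.
have dF : differentiable (f \o param (A p)) (A p q).
  by apply: smooth_on_diff (sf p) _; exists q.
have dT := chart_change_diff qq pq.
rewrite /chart_change.
apply: eq_trans (diff_compE v E dT dF).
apply: near_eq_diff; last by apply: differentiable_comp => //; rewrite E.
near=> x.
have [y [qy py] <-] : (A q @` (dom (A q) `&` dom (A p))) x.
  by near: x; exact: near_chart_overlap.
by rewrite /= qK ?inE// pK ?inE.
Unshelve. all: by end_near. Qed.

Lemma lie_derivative_chart (p : M) (W : M -> 'rV[R]_n)
    (U : set 'rV[R]_n) (Y : 'rV[R]_n -> 'rV[R]_n) :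
  open U -> U (A p p) ->
  (forall q, dom (A p) q -> U (A p q) ->
     chart_change (A q) (A p) q (W q) = Y (A p q)) ->
  {near A p p, (fun x => 'd (f \o param (A p)) x (Y x)) =1
               lie_derivative A W f \o param (A p)}.
Proof.
move=> oU Up WY; case: (mA) => _ _ cA _; have [[_ _ pK _ _] pp] := cA p.
near=> x.
have [y [py _] xy] : (A p @` (dom (A p) `&` dom (A p))) x.
  by near: x; exact: near_chart_overlap.
have : U x by near: x; exact: open_nbhs_nbhs.
rewrite -xy => Uy; rewrite /= pK ?inE// /lie_derivative.
by apply/esym; apply: (eq_trans (diff_chart (W y) py)); rewrite WY.
Unshelve. all: by end_near. Qed.

(* Independence of the Hessian at a critical point of the extensions. *)
Lemma hessianE (p : M) (V W : M -> 'rV[R]_n) :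
  critical_set A f p ->
  smooth_field_along A setT V -> smooth_field_along A setT W ->
  lie_derivative A V (lie_derivative A W f) p = hessian A f p (V p) (W p).
Proof.
move=> crp _ /(_ p I)[U [Y [oU Up sY WY]]]; case: (mA) => _ _ cA _.
have [[_ op pK _ _] pp] := cA p.
have dF := smooth_on_diff (sf p).
have pim : (A p @` dom (A p)) (A p p) by exists p.
have dY := smooth_on_diff sY Up.
have WYp : W p = Y (A p p) by rewrite -WY// chart_changexx.
have key (Z : M -> 'rV[R]_n) (X : 'rV[R]_n -> 'rV[R]_n) v :
    smooth_on U X ->
    (forall q, dom (A p) q -> U (A p q) ->
       chart_change (A q) (A p) q (Z q) = X (A p q)) ->
    'd (lie_derivative A Z f \o param (A p)) (A p p) v =
    \sum_(i < n) X (A p p) ord0 i *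
      'd ('D_(delta_mx ord0 i) (f \o param (A p))) (A p p) v.
  move=> sX ZX; have dX := smooth_on_diff sX Up.
  have [dd dE] := diff_diff v op pim (sf p) dX crp.
  exact: eq_trans (near_eq_diff v (lie_derivative_chart oU Up ZX) dd) dE.
have sW : smooth_on U (cst (W p)) by exact: smooth_on_cst.
apply: eq_trans (key W Y (V p) sY (fun q pq => WY q I pq)) _.
apply/esym/(eq_trans (key _ (cst (W p)) _ sW _)).
  by move=> q pq _; rewrite /constant_field chart_changeK//; case: (cA q).
by rewrite /constant_field chart_changexx// /cst WYp.
Qed.

End HessianWellDefined.

(* Main.v *)
Require Import Defs.
From HB Require Import structures.
From mathcomp Require Import all_boot all_order all_algebra.
From mathcomp Require Import all_classical all_reals all_analysis.
From mathcomp Require Import measurable_realfun ring lra.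

Set Implicit Arguments.
Unset Strict Implicit.
Unset Printing Implicit Defensive.

Import Order.TTheory GRing.Theory Num.Theory.
Import numFieldNormedType.Exports.

Local Open Scope classical_set_scope.
Local Open Scope ring_scope.

(* Let C be the critical component of p, of dimension k. As T_pC = T_p(G.p), the
   orbit map G -> C of p is a submersion at 1, so by the inverse function theorem
   it has a smooth local section; hence orbits are open and closed in C, C lies in
   a single orbit, and the stability hypothesis holds at some point q of the given
   orbit S. Let H be the stabilizer of q. If u is an eigenvector of A_q with
   eigenvalue l < 0, so is its average over H, and z = u - average u is a normal
   vector in N''_q with Hess(z,z) = l g(z,z); positivity on N'' forces z = 0, so u
   is fixed by H. Thus H acts trivially on N^-_q, and (a.q, v) |-> d(a)_q v is a
   well defined equivariant trivialization S x N^-_q -> N^-(S), smooth thanks to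
   the local sections. *)

(** * Calculus of smooth maps between normed spaces *)

(** [G] may be disconnected, and this shapes the proof. An orbit can then meet several components of
    the critical set, whereas the Morse-Bott hypotheses describe one component C at a time: the
    orbit map of p is known to land in C only near 1, and its local section is a section only over
    C. A separate compactness argument shows that near each of its points a critical orbit stays in
    the component of that point; only then does the section cover all nearby points of S.

    The elements a with a.q = s form a coset of H, so d(a)_q v depends on s alone exactly when H
    fixes v. This also settles smoothness: the trivialization is defined with elements picked by
    choice, without any regularity, and near a given point these may be exchanged for the ones that
    the smooth section provides.

    The inverse function theorem is needed in equal dimensions, while the orbit map goes from
    dimension m to dimension k. A linear lift of the first k coordinate directions to the group,
    together with the identity on the remaining n - k coordinates, yields a map of R^n to itself. *)

Section SmoothMaps.
Context {R : realType}.
Implicit Types (V W : normedModType R).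

(** Derivatives are functions on the whole space with unspecified values off [U]. Openness of [U]
    lets an equality on [U] pass to the derivatives, so that a formula valid only there may replace
    ['D_v f]; the closure properties below all rely on this. *)
Lemma k_differentiable_ext V W k (U : set V) (f g : V -> W) :
  open U -> (forall x, U x -> f x = g x) ->
  k_differentiable k U f -> k_differentiable k U g.
Proof.
move=> oU; elim: k f g => [//|k IH] f g fg [df dDf].
have nfg x : U x -> {near x, f =1 g}.
  by move=> Ux; near=> y; apply: fg; near: y; exact: open_nbhs_nbhs.
split=> [x Ux|v]; first by have [] := near_eq_is_diff (nfg x Ux) (df x Ux).
apply: IH (dDf v) => x Ux.
exact: near_eq_derive (nfg x Ux).
Unshelve. all: by end_near. Qed.

Lemma k_differentiable_subset V W k (U U' : set V) (f : V -> W) :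
  U' `<=` U -> k_differentiable k U f -> k_differentiable k U' f.
Proof.
move=> sU; elim: k f => [//|k IH] f [df dDf].
by split=> [x /sU|v]; [exact: df | exact: IH (dDf v)].
Qed.

Lemma k_differentiableW V W k (U : set V) (f : V -> W) :
  k_differentiable k.+1 U f -> k_differentiable k U f.
Proof.
elim: k f => [//|k IH] f [df dDf]; split=> [x Ux|v]; first exact: df.
exact: IH (dDf v).
Qed.

Lemma k_differentiable_cst V W k (U : set V) (a : W) :
  k_differentiable k U (cst a).
Proof. exact: smooth_on_cst. Qed.

Lemma k_differentiableD V W k (U : set V) (f g : V -> W) : open U ->
  k_differentiable k U f -> k_differentiable k U g ->
  k_differentiable k U (f + g).
Proof.
move=> oU; elim: k f g => [//|k IH] f g [df dDf] [dg dDg].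
split=> [x Ux|v]; first by apply: differentiableD; [exact: df|exact: dg].
apply: (@k_differentiable_ext _ _ _ _ ('D_v f + 'D_v g)) => //; last first.
  exact: IH (dDf v) (dDg v).
by move=> x Ux; rewrite deriveD//; apply: diff_derivable; [exact: df|exact: dg].
Qed.

Lemma k_differentiable_sum V W k (U : set V) (I : Type) (s : seq I)
    (P : pred I) (f : I -> V -> W) : open U ->
  (forall i, P i -> k_differentiable k U (f i)) ->
  k_differentiable k U (fun x => \sum_(i <- s | P i) f i x).
Proof.
move=> oU df; elim: s => [|i s IH].
  apply: (@k_differentiable_ext _ _ _ _ (cst 0)) => //.
    by move=> x _; rewrite big_nil.
  exact: k_differentiable_cst.
have [Pi|Pi] := boolP (P i); last first.
  by apply: k_differentiable_ext IH => // x _; rewrite big_cons (negbTE Pi).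
apply: (@k_differentiable_ext _ _ _ _
  (f i + (fun x => \sum_(i <- s | P i) f i x))) => //.
  by move=> x _; rewrite big_cons Pi.
by apply: k_differentiableD => //; exact: df.
Qed.

Lemma continuous_linear_differentiable V W (L : V -> W) x :
  linear L -> continuous L -> differentiable L x /\ 'd L x = L :> (V -> W).
Proof.
move=> lL cL; pose LL := GRing.isLinear.Build R V W _ L lL.
pose L' : {linear V -> W} := HB.pack L LL.
split; first exact: (@linear_differentiable _ _ _ L').
exact: (@diff_lin _ _ _ L').
Qed.

Lemma k_differentiable_linear V W W' k (U : set V) (L : W -> W') (f : V -> W) :
  open U -> linear L -> continuous L ->
  k_differentiable k U f -> k_differentiable k U (L \o f).
Proof.
move=> oU lL cL; elim: k f => [//|k IH] f [df dDf].
have dL y := continuous_linear_differentiable y lL cL.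
split=> [x Ux|v].
  by apply: differentiable_comp; [exact: df | have [] := dL (f x)].
apply: k_differentiable_ext (IH _ (dDf v)) => // x Ux.
have dLf : differentiable L (f x) by have [] := dL (f x).
rewrite [RHS]deriveE; last by apply: differentiable_comp => //; exact: df.
rewrite (diff_compE _ erefl (df _ Ux) dLf) (dL (f x)).2 /= deriveE//.
exact: df.
Qed.

Lemma k_differentiableM V k (U : set V) (f g : V -> R) : open U ->
  k_differentiable k U f -> k_differentiable k U g ->
  k_differentiable k U (fun x => f x * g x).
Proof.
move=> oU; elim: k f g => [//|k IH] f g sf sg.
have [df dDf] := sf; have [dg dDg] := sg.
have sf' := k_differentiableW sf; have sg' := k_differentiableW sg.
split=> [x Ux|v]; first by apply: differentiableM; [exact: df|exact: dg].
apply: (@k_differentiable_ext _ _ _ _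
    ((fun x => f x * 'D_v g x) + (fun x => g x * 'D_v f x))) => //.
  move=> x Ux; rewrite -[RHS]/('D_v (f * g) x) deriveM//.
  - by apply: diff_derivable; exact: df.
  - by apply: diff_derivable; exact: dg.
by apply: k_differentiableD => //; [exact: IH sf' (dDg v)|exact: IH sg' (dDf v)].
Qed.

Lemma k_differentiable_prod V k (U : set V) (I : Type) (s : seq I)
    (f : I -> V -> R) : open U ->
  (forall i, k_differentiable k U (f i)) ->
  k_differentiable k U (fun x => \prod_(i <- s) f i x).
Proof.
move=> oU df; elim: s => [|i s IH].
  apply: (@k_differentiable_ext _ R^o _ _ (cst (1 : R))) => //.
    by move=> x _; rewrite big_nil.
  exact: k_differentiable_cst.
apply: (@k_differentiable_ext _ _ _ _
  (fun x => f i x * \prod_(i <- s) f i x)) => //.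
  by move=> x _; rewrite big_cons.
exact: k_differentiableM.
Qed.

(** The derivative - f' / f^2 contains 1 / f again, but one order lower, so the induction closes for
    a fixed [f]. *)
Lemma k_differentiableV V k (U : set V) (f : V -> R) : open U ->
  (forall x, U x -> f x != 0) ->
  k_differentiable k U f -> k_differentiable k U (fun x => (f x)^-1).
Proof.
move=> oU f0; elim: k => [//|k IH] sf; have [df dDf] := sf.
have sV := IH (k_differentiableW sf).
split=> [x Ux|v]; first by apply: differentiableV; [exact: df|exact: f0].
apply: (@k_differentiable_ext _ _ _ _
    (fun x => -1 * ((f x)^-1 * (f x)^-1 * 'D_v f x))) => //.
  move=> x Ux; rewrite [RHS]deriveV; last 2 first.
  - exact: f0.
  - by apply: diff_derivable; exact: df.
  by rewrite /GRing.scale/= expr2 invfM mulN1r mulNr.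
apply: k_differentiableM => //; first exact: k_differentiable_cst.
by apply: k_differentiableM (dDf v) => //; exact: k_differentiableM.
Qed.

Lemma coord_linear m n (i : 'I_m) (j : 'I_n) :
  linear (fun M : 'M[R]_(m, n) => M i j : R^o).
Proof. by move=> a u v; rewrite !mxE. Qed.

Lemma k_differentiable_coord V n k (U : set V) (f : V -> 'rV[R]_n) i : open U ->
  k_differentiable k U f -> k_differentiable k U (fun x => f x ord0 i).
Proof.
move=> oU; apply: (@k_differentiable_linear V _ R^o k U
  (fun M : 'rV[R]_n => M ord0 i)) => //.
- exact: coord_linear.
- by move=> x; exact: coord_continuous.
Qed.

Lemma k_differentiable_row V n k (U : set V) (f : V -> 'rV[R]_n) : open U ->
  (forall i, k_differentiable k U (fun x => f x ord0 i)) ->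
  k_differentiable k U f.
Proof.
move=> oU df.
apply: (@k_differentiable_ext _ _ _ _
    (fun x => \sum_(i < n) f x ord0 i *: delta_mx ord0 i)) => //.
  by move=> x _; rewrite -row_sum_delta.
apply: k_differentiable_sum => // i _.
apply: (@k_differentiable_linear V R^o _ k U
  (fun a => a *: (delta_mx ord0 i : 'rV[R]_n))) (df i) => //.
- by move=> a u v; rewrite scalerDl scalerA.
- exact: scalel_continuous.
Qed.

Lemma k_differentiable_id V k (U : set V) : k_differentiable k U id.
Proof.
case: k => [//|k]; split=> [x _|v]; first exact: ex_diff.
have -> : 'D_v id = cst v :> (V -> V) by apply/funext => x; exact: derive_id.
exact: k_differentiable_cst.
Qed.

(** Continuity is not assumed but follows from finite dimension: [L] is a finite sum of coordinates
    times constant vectors. *)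
Lemma smooth_linear_rV n W (U : set 'rV[R]_n) (L : 'rV[R]_n -> W) :
  open U -> linear L -> smooth_on U L.
Proof.
move=> oU lL k; pose LL := GRing.isLinear.Build R _ W _ L lL.
pose L' : {linear 'rV[R]_n -> W} := HB.pack L LL.
apply: (@k_differentiable_ext _ _ _ _
    (fun x : 'rV[R]_n => \sum_(i < n) x ord0 i *: L (delta_mx ord0 i))) => //.
  move=> x _; rewrite -[RHS]/(L' x) [in RHS](row_sum_delta x) linear_sum.
  by apply: eq_bigr => i _; rewrite linearZ.
apply: k_differentiable_sum => // i _.
apply: (@k_differentiable_linear _ R^o _ k U
  (fun a => a *: L (delta_mx ord0 i))
  (fun x : 'rV[R]_n => x ord0 i)) => //.
- by move=> a u v; rewrite scalerDl scalerA.
- exact: scalel_continuous.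
- by apply: k_differentiable_coord => //; exact: k_differentiable_id.
Qed.

Lemma linear_rV_continuous n W (L : 'rV[R]_n -> W) : linear L -> continuous L.
Proof.
move=> lL x; apply: differentiable_continuous.
exact: smooth_on_diff (smooth_linear_rV openT lL) _.
Qed.

Lemma diff_linear_rV n W (L : 'rV[R]_n -> W) x :
  linear L -> differentiable L x /\ 'd L x = L :> ('rV[R]_n -> W).
Proof.
by move=> lL; apply: continuous_linear_differentiable (linear_rV_continuous lL).
Qed.

Lemma diff_sum_partial n W (f : 'rV[R]_n -> W) x v :
  differentiable f x ->
  'd f x v = \sum_(i < n) v ord0 i *: 'D_(delta_mx ord0 i) f x.
Proof.
move=> df; rewrite [in LHS](row_sum_delta v) linear_sum.
by apply: eq_bigr => i _; rewrite linearZ /= (deriveE _ df).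
Qed.

(** By the chain rule, the derivative of the composite is a sum of products of a coordinate of
    ['D_v f] with a partial derivative of [g] composed with [f]; the induction hypothesis is applied
    to these partial derivatives, hence for varying [g]. *)
Lemma k_differentiable_comp_scalar V n k (U : set V) (U' : set 'rV[R]_n)
    (f : V -> 'rV[R]_n) (g : 'rV[R]_n -> R) :
  open U -> open U' -> (forall x, U x -> U' (f x)) ->
  k_differentiable k U f -> k_differentiable k U' g ->
  k_differentiable k U (g \o f).
Proof.
move=> oU oU' fU; elim: k g => [//|k IH] g sf [dg dDg]; have [df dDf] := sf.
split=> [x Ux|v].
  by apply: differentiable_comp; [exact: df | apply: dg; exact: fU].
have sf' := k_differentiableW sf.
apply: (@k_differentiable_ext _ _ _ _ (fun x => \sum_(i < n)
    'D_v f x ord0 i * ('D_(delta_mx ord0 i) g \o f) x)) => //.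
  move=> x Ux; have dgx := dg _ (fU _ Ux); have dfx := df _ Ux.
  rewrite [RHS]deriveE; last exact: differentiable_comp.
  rewrite (diff_compE _ erefl dfx dgx) -(deriveE v dfx).
  rewrite [in RHS](row_sum_delta ('D_v f x)) linear_sum.
  by apply: eq_bigr => i _; rewrite linearZ /= (deriveE _ dgx).
apply: k_differentiable_sum => // i _; apply: k_differentiableM => //.
  exact: k_differentiable_coord (dDf v).
exact: IH (dDg _).
Qed.

Lemma k_differentiable_comp V n p k (U : set V) (U' : set 'rV[R]_n)
    (f : V -> 'rV[R]_n) (g : 'rV[R]_n -> 'rV[R]_p) :
  open U -> open U' -> (forall x, U x -> U' (f x)) ->
  k_differentiable k U f -> k_differentiable k U' g ->
  k_differentiable k U (g \o f).
Proof.
move=> oU oU' fU sf sg; apply: k_differentiable_row => // i.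
apply: (k_differentiable_comp_scalar (g := fun y => g y ord0 i)) fU sf _ => //.
exact: k_differentiable_coord.
Qed.

Lemma k_differentiable_det V n k (U : set V) (F : V -> 'M[R]_n) : open U ->
  (forall i j, k_differentiable k U (fun x => F x i j)) ->
  k_differentiable k U (fun x => \det (F x)).
Proof.
move=> oU dF; apply: k_differentiable_sum => // s _.
apply: k_differentiableM => //; first exact: k_differentiable_cst.
exact: k_differentiable_prod.
Qed.

Lemma k_differentiable_invmx V n k (U : set V) (F : V -> 'M[R]_n) i j :
  open U -> (forall x, U x -> F x \in unitmx) ->
  (forall i j, k_differentiable k U (fun x => F x i j)) ->
  k_differentiable k U (fun x => invmx (F x) i j).
Proof.
move=> oU uF dF.
apply: (@k_differentiable_ext _ _ _ _
    (* Cramer's rule: the inverse is the adjugate divided by the determinant. *)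
    (fun x => (\det (F x))^-1 * ((-1) ^+ (j + i) *
      \det (row' j (col' i (F x)))))) => //.
  by move=> x Ux; rewrite /invmx uF// !mxE.
apply: k_differentiableM => //.
  apply: k_differentiableV => //; last exact: k_differentiable_det.
  by move=> x Ux; rewrite -unitfE -unitmxE uF.
apply: k_differentiableM => //; first exact: k_differentiable_cst.
apply: k_differentiable_det => // i' j'.
by apply: k_differentiable_ext (dF (lift j i') (lift i j')) => // x _; rewrite !mxE.
Qed.

End SmoothMaps.

(** * The inverse function theorem *)

Section RowNorm.
Context {R : realType}.

Lemma rV_norm_le n (z : 'rV[R]_n) (C : R) :
  0 <= C -> (forall j, `|z ord0 j| <= C) -> `|z| <= C.
Proof.
move=> C0 zC; rewrite [leLHS]/Num.norm /= mx_normrE; apply/bigmax_leP.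
by split=> // -[i j] _ /=; rewrite ord1.
Qed.

Lemma rV_coord_le n (z : 'rV[R]_n) j : `|z ord0 j| <= `|z|.
Proof.
rewrite [leRHS]/Num.norm /= mx_normrE; apply/bigmax_geP; right => /=.
by exists (ord0, j).
Qed.

(** The norm is the maximum of the coordinates, so the one-variable mean value theorem is applied to
    each coordinate along the segment from [y] to [x]. The factor [n] counts the partial
    derivatives. *)
Lemma ball_mean_value n p (h : 'rV[R]_n -> 'rV[R]_p) (x0 : 'rV[R]_n) (r c : R) :
  0 <= c ->
  (forall x : 'rV[R]_n, `|x - x0| < r -> differentiable h x /\
     forall i, `|'D_(delta_mx ord0 i) h x| <= c) ->
  forall x y : 'rV[R]_n, `|x - x0| < r -> `|y - x0| < r ->
  `|h x - h y| <= n%:R * c * `|x - y|.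
Proof.
move=> c0 hd x y xr yr; apply: rV_norm_le; first by rewrite !mulr_ge0.
move=> j; pose l (t : R) := y + t *: (x - y).
have lr (t : R) : 0 <= t <= 1 -> `|l t - x0| < r.
  move=> /andP[t0 t1].
  have -> : l t - x0 = (1 - t) *: (y - x0) + t *: (x - x0).
    rewrite /l !scalerBr scalerBl scale1r !scalerBl !scale1r.
    by apply/rowP => i; rewrite !mxE; ring.
  apply: le_lt_trans (ler_normD _ _) _; rewrite !normrZ.
  rewrite ger0_norm ?subr_ge0// (ger0_norm t0).
  (* The strict inequality is taken from the [x] term, which is absent for [t = 0]; there the point
     is [y] itself. *)
  have [->|tn0] := eqVneq t 0; first by rewrite subr0 mul1r mul0r addr0.
  have tp : 0 < t by rewrite lt0r tn0.
  have -> : r = (1 - t) * r + t * r by ring.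
  by apply: ler_ltD; [rewrite ler_wpM2l ?subr_ge0// ltW | rewrite ltr_pM2l].
pose phi (t : R) : R := h (l t) ord0 j.
have dphi (t : R) : 0 <= t <= 1 -> is_derive t 1 phi ('d h (l t) (x - y) ord0 j).
  move=> /lr /hd[dh _].
  have dl : is_diff t l ( *:%R^~ (x - y)).
    rewrite -[X in is_diff _ _ X]add0r; apply: is_diffD.
  have dhl : differentiable (h \o l) t by exact: differentiable_comp.
  have cL := @coord_linear R 1 p ord0 j.
  have [dc cE] := diff_linear_rV (h (l t)) cL.
  have dphi : differentiable phi t by exact: differentiable_comp dhl dc.
  apply: DeriveDef; first exact: diff_derivable.
  rewrite deriveE// (@diff_compE _ _ _ _ (h \o l)
    (fun M : 'rV[R]_p => M ord0 j : R^o) t _ _ erefl)// cE.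
  by rewrite (diff_compE _ erefl _ dh)// diff_val scale1r.
have [||t t01 phiE] := @MVT_segment R phi
    (fun t => 'd h (l t) (x - y) ord0 j) 0 1 ler01.
- by move=> t; rewrite in_itv/= => /andP[t0 t1]; apply: dphi; rewrite !ltW.
- apply: continuous_in_subspaceT => t; rewrite inE/= in_itv/= => /dphi[dt _].
  exact/differentiable_continuous/derivable1_diffP.
have := phiE; rewrite subr0 mulr1 /phi /l scale1r scale0r addr0.
rewrite [y + _]addrC subrK !mxE => ->.
have [dht Dht] := hd _ (lr t t01).
apply: le_trans (rV_coord_le _ _) _; rewrite (diff_sum_partial _ dht).
apply: le_trans (ler_norm_sum _ _ _) _.
have -> : n%:R * c * `|x - y| = \sum_(i < n) `|x - y| * c.
  by rewrite sumr_const card_ord -mulr_natl; ring.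
apply: ler_sum => i _; rewrite normrZ.
by apply: ler_pM => //; exact: rV_coord_le.
Qed.

Lemma diff_near (V W : normedModType R) (f : V -> W) x e :
  differentiable f x -> 0 < e ->
  \forall k \near 0, `|f (k + x) - (f x + 'd f x k)| <= e * `|k|.
Proof. by move=> /diff_locallyP[_ /eqaddoP]; exact. Qed.

Lemma near_diff (V W : normedModType R) (f : V -> W) (L : {linear V -> W}) x :
  continuous L ->
  (forall e, 0 < e ->
    \forall k \near 0, `|f (k + x) - (f x + L k)| <= e * `|k|) ->
  differentiable f x /\ 'd f x = L :> (V -> W).
Proof.
move=> Lc fL; have eL : f \o shift x = cst (f x) + L +o_ 0 id.
  by apply/eqaddoP => e /fL.
have dL := diff_unique Lc eL; split=> //.
by apply/diff_locallyP; rewrite dL.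
Qed.

(* T x = y means that x is a fixed point of x |-> y + h x, with h := id - T; since
   dh(x0) = 0, this map is a contraction near x0. *)
Lemma smooth_right_inverse n (U : set 'rV[R]_n) (T : 'rV[R]_n -> 'rV[R]_n)
    (x0 : 'rV[R]_n) :
  open U -> U x0 -> smooth_on U T -> (forall v, 'd T x0 v = v) ->
  exists (V : set 'rV[R]_n) (S : 'rV[R]_n -> 'rV[R]_n),
    [/\ open V, V (T x0), smooth_on V S &
        forall y, V y -> U (S y) /\ T (S y) = y].
Proof.
move=> oU Ux0 sT dT0; pose h (x : 'rV[R]_n) := x - T x.
have sh k : k_differentiable k U h.
  have -> : h = id + (-1 *: T) by apply/funext => x; rewrite scaleN1r.
  apply: k_differentiableD => //; first exact: k_differentiable_id.
  apply: (@k_differentiable_linear _ _ _ _ _ U ( *:%R (-1))) => //.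
  - by move=> a u v; rewrite scalerDr !scalerA mulrC.
  - exact: scaler_continuous.
pose J (x : 'rV[R]_n) := \matrix_(i, j) 'D_(delta_mx ord0 i) T x ord0 j.
have sJ k i j : k_differentiable k U (fun x => J x i j).
  apply: (@k_differentiable_ext _ _ _ _ _
    (fun x => 'D_(delta_mx ord0 i) T x ord0 j)) => // [x _|].
    by rewrite mxE.
  by apply: k_differentiable_coord => //; have [_ dT] := sT k.+1; exact: dT.
have JE x v : U x -> 'd T x v = v *m J x.
  move=> Ux; rewrite (diff_sum_partial _ (smooth_on_diff sT Ux)).
  apply/rowP => j; rewrite summxE mxE.
  by apply: eq_bigr => i _; rewrite !mxE.
have J0 : J x0 = 1%:M.
  apply/row_matrixP => i.
  by rewrite [in LHS]rowE -JE// dT0 rowE mulmx1.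
(* The mean value bound costs a factor [n]; this [c] makes [h] Lipschitz with constant 1/2. Dividing
   by [n.+1] keeps [c] positive when [n = 0]. *)
pose c : R := 2^-1 / n.+1%:R.
have c0 : 0 < c by rewrite divr_gt0.
have nc : n%:R * c <= 2^-1.
  rewrite /c mulrC -mulrA ler_piMr// mulrC ler_pdivrMr// mul1r.
  by rewrite ler_nat.
have [r r0 hr] : exists2 r : R, 0 < r & forall x, `|x - x0| < r ->
    [/\ U x, J x \in unitmx & forall i, `|'D_(delta_mx ord0 i) h x| <= c].
  have nU : \forall x \near x0, U x by exact: open_nbhs_nbhs.
  have nJ : \forall x \near x0, J x \in unitmx.
    have dJ : differentiable (fun x => \det (J x)) x0.
      by have [d _] := k_differentiable_det oU (sJ 1%N); exact: d.
    have /differentiable_continuous /(_ [set x | x != 0]) := dJ.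
    rewrite J0 det1 => nJ.
    have : \forall x \near x0, \det (J x) != 0.
      by apply: nJ; apply: open_nbhs_nbhs; split; [exact: open_neq|exact: oner_neq0].
    by apply: filterS => x; rewrite unitmxE unitfE.
  have nh : \forall x \near x0, forall i, `|'D_(delta_mx ord0 i) h x| <= c.
    suff nhi i : \forall x \near x0, `|'D_(delta_mx ord0 i) h x| <= c.
      pose Dh i x := `|'D_(delta_mx ord0 i) h x| <= c.
      exact: (@filter_forall _ _ Dh _ _ nhi).
    have [_ /(_ (delta_mx ord0 i)) [dDh _]] := sh 2%N.
    have /differentiable_continuous /cvg_norm := dDh _ Ux0.
    have -> : 'D_(delta_mx ord0 i) h x0 = 0.
      have hT : differentiable T x0 by exact: smooth_on_diff sT _.
      rewrite deriveE; last by have [d _] := sh 1%N; exact: d.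
      have [_ dhE] := is_diffB (is_diff_id x0) (differentiableP hT).
      by rewrite -[h]/(id - T) dhE -[LHS]/(_ - 'd T x0 _) dT0 subrr.
    rewrite normr0 => /cvgr_le; exact.
  have : \forall x \near x0, [/\ U x, J x \in unitmx &
      forall i, `|'D_(delta_mx ord0 i) h x| <= c].
    by near=> x; split; near: x.
  move=> /nbhs_ballP[r /= r0 rP].
  exists r => // x xr; apply: rP.
  by rewrite -ball_normE /= distrC.
have hlip x y : `|x - x0| < r -> `|y - x0| < r ->
    `|h x - h y| <= 2^-1 * `|x - y|.
  move=> xr yr; apply: le_trans (_ : n%:R * c * `|x - y| <= _); last first.
    by rewrite ler_wpM2r.
  apply: ball_mean_value xr yr; first exact: ltW.
  move=> z /hr[Uz _ zc]; split=> //.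
  by have [d _] := sh 1%N; exact: d.
(* As x - y = (h x - h y) + (T x - T y) and the first term is at most half of |x - y|. This makes
   the chosen preimages vary in a Lipschitz way with constant 2. *)
have Tlip x y : `|x - x0| < r -> `|y - x0| < r -> `|x - y| <= 2 * `|T x - T y|.
  move=> xr yr; have := hlip _ _ xr yr.
  have : `|x - y| <= `|h x - h y| + `|T x - T y|.
    apply: le_trans (ler_normD _ _); rewrite le_eqVlt; apply/orP; left.
    by apply/eqP; congr `|_|; rewrite /h; apply/rowP => i; rewrite !mxE; ring.
  lra.
(* The closed ball of radius r/2 is mapped to itself because r/4 + (1/2)(r/2) = r/2; it is closed,
   as the fixed point theorem requires, and lies in the open ball of radius r. *)
have surj y : `|y - T x0| < r / 4 -> exists x, `|x - x0| < r /\ T x = y.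
  move=> yr; pose Bx := [set x : 'rV[R]_n | `|x - x0| <= r / 2].
  have rB x : Bx x -> `|x - x0| < r by rewrite /Bx /=; lra.
  have fB : set_fun Bx Bx (fun x => y + h x).
    move=> x Bxx; rewrite /Bx /=.
    have -> : y + h x - x0 = (y - T x0) + (h x - h x0).
      by rewrite /h; apply/rowP => i; rewrite !mxE; ring.
    apply: le_trans (ler_normD _ _) _.
    have x0r : `|x0 - x0| < r by rewrite subrr normr0.
    have := hlip _ _ (rB _ Bxx) x0r; move: Bxx; rewrite /Bx /=; lra.
  pose ff := isFun.Build _ _ Bx Bx (fun x => y + h x) fB.
  pose F : {fun Bx >-> Bx} := HB.pack (fun x => y + h x) ff.
  have Fc : is_contraction F.
    have h0 : 0 <= 2^-1 :> R by [].
    exists (NngNum h0); split => /=; first by lra.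
    move=> [x x'] [/= /rB xr /rB xr'].
    rewrite opprD addrACA subrr add0r; exact: hlip.
  have [||x Bxx xE] := @banach_fixed_point R (HB.pack 'rV[R]_n) Bx F Fc.
  - rewrite (_ : Bx = (fun x => `|x - x0|) @^-1` [set t | t <= r / 2])//.
    apply: closed_comp; last exact: closed_le.
    move=> x _; apply: continuous_comp; last exact: norm_continuous.
    by apply: continuousB => //; exact: cst_continuous.
  - by exists x0; rewrite /Bx /= subrr normr0; lra.
  exists x; split; first exact: rB.
  have : x = y + h x by [].
  by rewrite /h addrA => /eqP; rewrite eq_sym subr_eq addrC => /eqP/addrI.
pose S (y : 'rV[R]_n) : 'rV[R]_n := xget 0 [set x | `|x - x0| < r /\ T x = y].
have SP y : `|y - T x0| < r / 4 -> `|S y - x0| < r /\ T (S y) = y.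
  by move=> /surj; apply: xgetPex.
pose V := [set y : 'rV[R]_n | `|y - T x0| < r / 4].
have oV : open V.
  rewrite (_ : V = (fun x => `|x - T x0|) @^-1` [set t | t < r / 4])//.
  apply: open_comp; last exact: open_lt.
  move=> x _; apply: continuous_comp; last exact: norm_continuous.
  by apply: continuousB => //; exact: cst_continuous.
have SU y : V y -> U (S y) by move=> /SP[/hr[]].
have dS y : V y -> differentiable S y /\
    'd S y = mulmx ^~ (invmx (J (S y))) :> (_ -> 'rV[R]_n).
  move=> Vy; have [Sr TS] := SP _ Vy; have [USy uJ _] := hr _ Sr.
  set x := S y in Sr TS USy uJ *.
  pose K : {linear 'rV[R]_n -> 'rV[R]_n} := mulmxr (invmx (J x)).
  have Kc : continuous K by apply: linear_rV_continuous; exact: linearP.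
  have [C C0 KC] := linear_lipschitz Kc.
  apply: (near_diff Kc) => e e0.
  (* With u = S (k + y) - S y, the error u - K k equals K (u J - k), and u J - k is up to sign the
     first-order error of [T] at [S y]. Here [C] bounds [K] and |u| <= 2 |k|, so the total is C (e /
     (2 C)) 2 |k| = e |k|. *)
  have e1 : 0 < e / (2 * C) by rewrite divr_gt0// mulr_gt0.
  have := diff_near (smooth_on_diff sT USy) e1.
  move=> /nbhs_ballP[d /= d0 dP].
  have nV : \forall k \near (0 : 'rV[R]_n), V (k + y).
    by rewrite (near_shift y) /= sub0r; near=> z; rewrite /= subrK; near: z;
      exact: open_nbhs_nbhs.
  near=> k; rewrite /= -/x.
  have Vk : V (k + y) by near: k.
  have [Skr TSk] := SP _ Vk.
  pose u := S (k + y) - x.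
  have u2k : `|u| <= 2 * `|k|.
    by have := Tlip _ _ Skr Sr; rewrite TSk TS addrK.
  have ud : ball 0 d u.
    rewrite -ball_normE /= sub0r normrN; apply: le_lt_trans u2k _.
    rewrite mulrC -ltr_pdivlMr//; near: k.
    apply/nbhs_ballP; exists (d / 2); first by rewrite /= divr_gt0.
    by move=> z; rewrite -ball_normE /= sub0r normrN.
  have := dP _ ud; rewrite /= {1}/u subrK TSk TS JE// => uk.
  rewrite opprD addrA -/u.
  have -> : u - K k = K (u *m J x - k).
    by rewrite linearB /= mulmxK.
  apply: le_trans (KC _) _.
  have -> : `|u *m J x - k| = `|k + y - (y + u *m J x)|.
    by rewrite -normrN; congr `|_|; rewrite opprB opprD addrA addrK.
  apply: le_trans (_ : C * (e / (2 * C) * `|u|) <= _).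
    by rewrite ler_pM2l.
  apply: le_trans (_ : C * (e / (2 * C) * (2 * `|k|)) <= _).
    by rewrite ler_pM2l// ler_pM2l// divr_gt0// mulr_gt0.
  suff -> : C * (e / (2 * C) * (2 * `|k|)) = e * `|k| by [].
  by field; rewrite gt_eqF.
exists V, S; split=> //.
- by rewrite /V /= subrr normr0 divr_gt0.
(* Bootstrapping: the derivative of [S] is the inverse of [J] composed with [S], so smoothness of
   order k for [S] yields order k + 1. *)
- move=> k; elim: k => [//|k IH]; split=> [y /dS[]//|v].
  apply: (@k_differentiable_ext _ _ _ _ _
    (fun y => v *m invmx (J (S y)))) => // [y /dS[dSy Sy]|].
    by rewrite [RHS](deriveE v dSy) Sy.
  apply: k_differentiable_row => // j.
  apply: (@k_differentiable_ext _ _ R^o _ _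
    (fun y => \sum_i v ord0 i * invmx (J (S y)) i j)) => // [y _|].
    by rewrite mxE.
  apply: k_differentiable_sum => // i _; apply: k_differentiableM => //.
    exact: k_differentiable_cst.
  apply: k_differentiable_invmx => // [y /SP[/hr[]]//|i' j'].
  exact: k_differentiable_comp_scalar oU SU IH (sJ k i' j').
- by move=> y Vy; split; [exact: SU|have [] := SP _ Vy].
Unshelve. all: by end_near. Qed.

End RowNorm.

(** * Charts and smooth maps between manifolds *)

Section Charts.
Context {R : realType}.

Lemma smooth_on_subset (V W : normedModType R) (U U' : set V) (f : V -> W) :
  U' `<=` U -> smooth_on U f -> smooth_on U' f.
Proof. by move=> sU sf k; exact: k_differentiable_subset sU (sf k). Qed.

Lemma chart_image_open (M : topologicalType) n (c : chart R M n) (O : set M) :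
  is_chart c -> open O -> open (c @` (dom c `&` O)).
Proof.
move=> [od oi cK cc cp] oO; rewrite openE => _ [x [dx Ox] <-].
have xi : (c @` dom c) (c x) by exists x.
have n1 : \forall z \near c x, (c @` dom c) z by exact: open_nbhs_nbhs.
have n2 : \forall z \near c x, O (param c z).
  have := cp (c x) (mem_set xi); rewrite /continuous_at cK ?inE//.
  by apply; exact: open_nbhs_nbhs.
rewrite /interior; near=> z.
have [y dy yz] : (c @` dom c) z by near: z.
have Oz : O (param c z) by near: z.
by exists y => //; split=> //; move: Oz; rewrite -yz cK ?inE.
Unshelve. all: by end_near. Qed.

Lemma near_chart (M : topologicalType) n (c : chart R M n) (O : set M) x :
  is_chart c -> dom c x -> nbhs x O ->
  \forall z \near c x, exists y, [/\ dom c y, O y & c y = z].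
Proof.
move=> hc dx; rewrite nbhsE => -[P1 [oP1 Ox1] sO].
have : \forall z \near c x, (c @` (dom c `&` P1)) z.
  by apply: open_nbhs_nbhs; split; [exact: chart_image_open | exists x].
by apply: filterS => _ [y [dy Oy] <-]; exists y; split=> //; exact: sO.
Qed.

(** Differentiability makes sense only between normed spaces; a composite through a manifold is
    handled by inserting the chart [d], since near [x] it equals (F o param d) o (d o phi). Chain
    rules between manifolds come from here. *)
Lemma is_diff_through_chart (V W : normedModType R) (N : topologicalType) n
    (d : chart R N n) (phi : V -> N) (F : N -> W) (x : V) :
  is_chart d -> (\forall z \near x, dom d (phi z)) ->
  differentiable (d \o phi) x -> differentiable (F \o param d) (d (phi x)) ->
  is_diff x (F \o phi)
    ('d (F \o param d) (d (phi x)) \o 'd (d \o phi) x).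
Proof.
move=> [_ _ dK _ _] nd dphi dF.
have dc : differentiable ((F \o param d) \o (d \o phi)) x.
  exact: differentiable_comp.
rewrite -diff_comp//; apply: near_eq_is_diff dc.
by near=> z; rewrite /= dK// inE; near: z.
Unshelve. all: by end_near. Qed.

Lemma diff_through_chart (V W : normedModType R) (N : topologicalType) n
    (d : chart R N n) (phi : V -> N) (F : N -> W) (x v : V) :
  is_chart d -> (\forall z \near x, dom d (phi z)) ->
  differentiable (d \o phi) x -> differentiable (F \o param d) (d (phi x)) ->
  'd (F \o phi) x v = 'd (F \o param d) (d (phi x)) ('d (d \o phi) x v).
Proof. by move=> hd nd dphi dF; have [_ ->] := is_diff_through_chart hd nd dphi dF. Qed.

Lemma smooth_through_chart (V : normedModType R) (N : topologicalType) n p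
    (d : chart R N n) (U : set V) (O : set N) (phi : V -> N)
    (F : N -> 'rV[R]_p) :
  is_chart d -> open U -> open O ->
  (forall z, U z -> dom d (phi z) /\ O (phi z)) ->
  smooth_on U (d \o phi) -> smooth_on (d @` (dom d `&` O)) (F \o param d) ->
  smooth_on U (F \o phi).
Proof.
move=> hd oU oO UO sphi sF k; have [_ _ dK _ _] := hd.
apply: (@k_differentiable_ext _ _ _ _ _ ((F \o param d) \o (d \o phi))) => //.
  by move=> x /UO[dx _]; rewrite /= dK ?inE.
apply: k_differentiable_comp (sphi k) (sF k) => //.
  exact: chart_image_open.
by move=> x /UO[dx Ox]; exists (phi x).
Qed.

(** The chart condition of [smooth_manifold], isolated so that it can be verified for product
    atlases. *)
Definition charted (M : topologicalType) n (A : atlas R M n) :=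
  forall p, is_chart (A p) /\ dom (A p) p.

Lemma charted_smooth_manifold (M : topologicalType) n (A : atlas R M n) :
  smooth_manifold A -> charted A.
Proof. by case. Qed.

Section ProductAtlas.
Context (M N : topologicalType) (m n : nat).
Context (A : atlas R M m) (B : atlas R N n).

Lemma row_mx_linear_l : linear (fun u : 'rV[R]_m => row_mx u (0 : 'rV[R]_n)).
Proof. by move=> a u v; rewrite scale_row_mx add_row_mx scaler0 addr0. Qed.

Lemma row_mx_linear_r : linear (fun u : 'rV[R]_n => row_mx (0 : 'rV[R]_m) u).
Proof. by move=> a u v; rewrite scale_row_mx add_row_mx scaler0 addr0. Qed.

Lemma row_mx_continuous (T : topologicalType) (x : T) (u : T -> 'rV[R]_m)
    (v : T -> 'rV[R]_n) :
  {for x, continuous u} -> {for x, continuous v} ->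
  {for x, continuous (fun t => row_mx (u t) (v t))}.
Proof.
move=> cu cv.
rewrite (_ : (fun t => _) = fun t => row_mx (u t) 0 + row_mx 0 (v t)); last first.
  by apply/funext => t; rewrite add_row_mx add0r addr0.
apply: (@continuousD _ _ _ (fun t => row_mx (u t) 0) (fun t => row_mx 0 (v t))).
  apply: (@continuous_comp _ _ _ u (fun w => row_mx w 0)) => //.
  exact: linear_rV_continuous row_mx_linear_l _.
apply: (@continuous_comp _ _ _ v (fun w => row_mx 0 w)) => //.
exact: linear_rV_continuous row_mx_linear_r _.
Qed.

Lemma charted_prod_atlas :
  charted A -> charted B -> charted (prod_atlas A B).
Proof.
move=> cA cB [p q]; have [[oA iA AK Ac Ap] pp] := cA p.
have [[oB iB BK Bc Bp] qq] := cB q.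
pose I := lsubmx @^-1` (A p @` dom (A p)) `&`
          rsubmx @^-1` (B q @` dom (B q)) : set 'rV[R]_(m + n).
have oI : open I.
  apply: openI; apply: open_comp => // x _.
  - exact: continuous_lsubmx.
  - exact: continuous_rsubmx.
have IE : (prod_atlas A B (p, q)) @` dom (prod_atlas A B (p, q)) = I.
  apply/seteqP; split=> [_ [[x y] [/= dx dy] <-]|z [[x dx xz] [y dy yz]]].
    by split; rewrite /= ?row_mxKl ?row_mxKr; [exists x | exists y].
  by exists (x, y) => //=; rewrite xz yz hsubmxK.
split; last by [].
split.
- rewrite openE => -[x y] [/= dx dy]; rewrite /interior.
  by exists (dom (A p), dom (B q)) => //=; split; exact: open_nbhs_nbhs.
- by rewrite IE.
- by move=> [x y] /set_mem[/= dx dy]; rewrite row_mxKl row_mxKr AK ?BK ?inE.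
- move=> [x y] /set_mem[/= dx dy].
  apply: (@row_mx_continuous _ (x, y) (fun t => A p t.1) (fun t => B q t.2));
    apply: continuous_comp.
  + exact: cvg_fst.
  + exact/Ac/mem_set.
  + exact: cvg_snd.
  + exact/Bc/mem_set.
- rewrite IE => z /set_mem[Az Bz].
  have c1 : {for z, continuous (param (A p) \o lsubmx)}.
    apply: continuous_comp; first exact: continuous_lsubmx.
    exact/Ap/mem_set.
  have c2 : {for z, continuous (param (B q) \o rsubmx)}.
    apply: continuous_comp; first exact: continuous_rsubmx.
    exact/Bp/mem_set.
  exact: cvg_pair c1 c2.
Qed.

End ProductAtlas.
End Charts.

Section SmoothMapsManifolds.
Context {R : realType}.

Section OneMap.
Context (M N : topologicalType) (m n : nat).
Context (A : atlas R M m) (B : atlas R N n).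
Hypotheses (cA : charted A) (cB : charted B).

Lemma open_chart_domain (F : M -> N) p q : continuous F ->
  open (A p @` (dom (A p) `&` F @^-1` dom (B q))).
Proof.
move=> cF; have [hA _] := cA p; have [[oB _ _ _ _] _] := cB q.
by apply: chart_image_open => //; apply: open_comp => // x _; exact: cF.
Qed.

Lemma smooth_map_diff (F : M -> N) p q x : smooth_map A B F ->
  dom (A p) x -> dom (B q) (F x) ->
  differentiable (B q \o F \o param (A p)) (A p x).
Proof.
by move=> [_ sF] px qx; apply: smooth_on_diff (sF p q) _; exists x.
Qed.

Lemma near_chart_map (F : M -> N) p x (O : set N) : continuous F ->
  open O -> dom (A p) x -> O (F x) ->
  \forall z \near A p x, O (F (param (A p) z)).
Proof.
move=> cF oO px Ox; have [hA _] := cA p; have [_ _ AK _ _] := hA.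
have nO : nbhs x (F @^-1` O) by exact: cF (open_nbhs_nbhs (conj oO Ox)).
near=> z; have [y [py Oy <-]] : exists y, [/\ dom (A p) y, (F @^-1` O) y & A p y = z].
  by near: z; exact: near_chart.
by rewrite AK ?inE.
Unshelve. all: by end_near. Qed.

Lemma tangent_map_linear (F : M -> N) p : linear (tangent_map A B F p).
Proof. exact: linearP. Qed.

(** Meant for slice charts, which are compatible with the atlas without having to belong to it. *)
Lemma smooth_map_smooth_chart (F : M -> N) p q (c : chart R N n) :
  smooth_map A B F -> is_chart c -> smooth_transition (B q) c ->
  smooth_on (A p @` (dom (A p) `&` F @^-1` (dom (B q) `&` dom c)))
    (c \o F \o param (A p)).
Proof.
move=> [cF sF] hc tc; have [hA _] := cA p; have [hB _] := cB q.
have [_ _ AK _ _] := hA; have [oB _ _ _ _] := hB; have [oc _ _ _ _] := hc.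
apply: (smooth_through_chart (O := dom c) (phi := F \o param (A p)) hB) => //.
- apply: chart_image_open => //; apply: open_comp; first by move=> x _; exact: cF.
  exact: openI.
- by move=> _ [x [px [Bx cx]] <-]; rewrite /= AK ?inE.
- apply: smooth_on_subset (sF p q).
  by move=> _ [x [px [Bx cx]] <-]; exists x.
Qed.

End OneMap.

Lemma tangent_map_comp (M N P : topologicalType) (m n k : nat)
    (A : atlas R M m) (B : atlas R N n) (C : atlas R P k)
    (F : M -> N) (G : N -> P) p q v :
  F p = q -> charted A -> charted B -> charted C ->
  smooth_map A B F -> smooth_map B C G ->
  tangent_map A C (G \o F) p v =
  tangent_map B C G q (tangent_map A B F p v).
Proof.
move=> <- cA cB cC sF sG; have [_ pp] := cA p.
have [hB Bp] := cB (F p); have [_ Cp] := cC (G (F p)).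
have [[_ _ AK _ _] _] := cA p; have [oB _ _ _ _] := hB.
have Ap : param (A p) (A p p) = p by rewrite AK ?inE.
have := @diff_through_chart _ _ _ _ _ (B (F p)) (F \o param (A p))
  (C (G (F p)) \o G) (A p p) v hB.
rewrite /tangent_map /= Ap; apply.
- by have [cF _] := sF; exact: (near_chart_map cA cF).
- exact: smooth_map_diff sF pp Bp.
- exact: smooth_map_diff sG Bp Cp.
Qed.

Lemma tangent_map_id (M : topologicalType) n (A : atlas R M n) p v :
  smooth_manifold A -> tangent_map A A id p v = v.
Proof.
move=> mA; have [_ _ cA _] := mA; have [_ pp] := cA p.
exact: (chart_changexx mA v pp).
Qed.

Section Partial.
Context (M N P : topologicalType) (m n k : nat).
Context (A : atlas R M m) (B : atlas R N n) (C : atlas R P k).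
Hypotheses (cA : charted A) (cB : charted B) (cC : charted C).
Context (F : M * N -> P) (sF : smooth_map (prod_atlas A B) C F).

Lemma smooth_row_mxr (U : set 'rV[R]_n) (a : 'rV[R]_m) : open U ->
  smooth_on U (fun u : 'rV[R]_n => row_mx a u).
Proof.
move=> oU j.
apply: (@k_differentiable_ext _ _ _ _ _ (cst (row_mx a 0) + row_mx 0)) => //.
  by move=> x _; rewrite /GRing.add/= add_row_mx addr0 add0r.
apply: k_differentiableD => //; first exact: k_differentiable_cst.
exact: smooth_linear_rV oU (@row_mx_linear_r R m n) j.
Qed.

Lemma smooth_row_mxl (U : set 'rV[R]_m) (a : 'rV[R]_n) : open U ->
  smooth_on U (fun u : 'rV[R]_m => row_mx u a).
Proof.
move=> oU j; apply: (@k_differentiable_ext _ _ _ _ _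
    (cst (row_mx 0 a) + (fun u => row_mx u 0))) => //.
  by move=> x _; rewrite /GRing.add/= add_row_mx addr0 add0r.
apply: k_differentiableD => //; first exact: k_differentiable_cst.
exact: smooth_linear_rV oU (@row_mx_linear_l R m n) j.
Qed.

Let joint p q r := C r \o F \o param (prod_atlas A B (p, q)).
Let jdom p q r := prod_atlas A B (p, q) @`
  (dom (prod_atlas A B (p, q)) `&` F @^-1` dom (C r)).

Lemma joint_open p q r : open (jdom p q r).
Proof.
exact: (open_chart_domain (charted_prod_atlas cA cB) cC sF.1).
Qed.

Lemma joint_dom p q r x y : dom (A p) x -> dom (B q) y ->
  dom (C r) (F (x, y)) -> jdom p q r (row_mx (A p x) (B q y)).
Proof. by move=> px qy rxy; exists (x, y). Qed.

Lemma smooth_map_partial_r x : smooth_map B C (fun y => F (x, y)).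
Proof.
have [cF _] := sF; have cFx : continuous (fun y => F (x, y)).
  move=> y; apply: (@continuous_comp _ _ _ (fun y => (x, y)) F); last exact: cF.
  by apply: cvg_pair; [exact: cvg_cst|exact: cvg_id].
split=> // q r; have [[_ _ AK _ _] xx] := cA x; have [[_ _ BK _ _] _] := cB q.
have oU := @open_chart_domain _ _ _ _ _ _ cB cC _ q r cFx.
move=> j; apply: (@k_differentiable_ext _ _ _ _ _
    (joint x q r \o row_mx (A x x))) => //.
  by move=> u _; rewrite /joint /= row_mxKl row_mxKr AK ?inE.
apply: (k_differentiable_comp (f := row_mx (A x x)) (g := joint x q r)
  oU (@joint_open x q r)) => //.
- by move=> _ [y [qy ry] <-]; exact: joint_dom.
- exact: smooth_row_mxr.
- by have [_] := sF; exact.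
Qed.

Lemma smooth_map_partial_l y : smooth_map A C (fun x => F (x, y)).
Proof.
have [cF _] := sF; have cFx : continuous (fun x => F (x, y)).
  move=> x; apply: (@continuous_comp _ _ _ (fun x => (x, y)) F); last exact: cF.
  by apply: cvg_pair; [exact: cvg_id|exact: cvg_cst].
split=> // p r; have [[_ _ AK _ _] _] := cA p; have [[_ _ BK _ _] yy] := cB y.
have oU := @open_chart_domain _ _ _ _ _ _ cA cC _ p r cFx.
move=> j; apply: (@k_differentiable_ext _ _ _ _ _
    (joint p y r \o (fun u => row_mx u (B y y)))) => //.
  by move=> u _; rewrite /joint /= row_mxKl row_mxKr BK ?inE.
apply: (k_differentiable_comp (f := fun u => row_mx u (B y y))
  (g := joint p y r) oU (@joint_open p y r)) => //.
- by move=> _ [x [px ry] <-]; exact: joint_dom.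
- exact: smooth_row_mxl.
- by have [_] := sF; exact.
Qed.

(** The right-hand side is a fixed directional derivative of one smooth map of both variables, so
    the differential of the partial map is seen to depend smoothly on the parameter [x]. For an
    action, this governs how the differential of [act a] varies with [a]. *)
Lemma diff_partial_r p q r x v : dom (A p) x -> dom (C r) (F (x, q)) ->
  'd (C r \o (fun y => F (x, y)) \o param (B q)) (B q q) v =
  'D_(row_mx 0 v) (C r \o F \o param (prod_atlas A B (p, q)))
     (row_mx (A p x) (B q q)).
Proof.
move=> px rx; have [[_ _ AK _ _] _] := cA p; have [_ qq] := cB q.
have dJ : differentiable (joint p q r) (row_mx (A p x) (B q q)).
  have [_ sJ] := sF; apply: smooth_on_diff (sJ (p, q) r) _; exact: joint_dom.
rewrite (deriveE _ dJ).
have -> : C r \o (fun y => F (x, y)) \o param (B q) =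
          joint p q r \o row_mx (A p x).
  by apply/funext => u; rewrite /joint /= row_mxKl row_mxKr AK ?inE.
have dr := smooth_on_diff (smooth_row_mxr (A p x) openT) (I : setT (B q q)).
rewrite (diff_compE v erefl dr dJ); congr ('d _ _ _).
have [dL LE] := diff_linear_rV (B q q) (@row_mx_linear_r R m n).
have [_ dE] := is_diffD (is_diff_cst (row_mx (A p x) 0) (B q q))
  (differentiableP dL).
have -> : row_mx (A p x) = cst (row_mx (A p x) 0) + row_mx 0 :> ('rV[R]_n -> _).
  by apply/funext => u; rewrite /GRing.add/= add_row_mx addr0 add0r.
by rewrite dE LE add0r.
Qed.

End Partial.
End SmoothMapsManifolds.

(** * Invariance of the Hessian *)

Section Hessian.
Context {R : realType} (M : topologicalType) (n : nat) (B : atlas R M n).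
Hypothesis mB : smooth_manifold B.
Context (f : M -> R) (sf : smooth_function B f).

(** Fields that are constant in the chart [B p] turn the Hessian into the second directional
    derivative in that chart. *)
Lemma hessian_derive p v w :
  hessian B f p v w = 'd ('D_w (f \o param (B p))) (B p p) v.
Proof.
have [_ _ cB _] := mB; have [hp pp] := cB p; have [_ op _ _ _] := hp.
have pim : (B p @` dom (B p)) (B p p) by exists p.
have ch q : dom (B p) q -> (B p @` dom (B p)) (B p q) ->
    chart_change (B q) (B p) q (constant_field B p w q) = cst w (B p q).
  by move=> pq _; rewrite /constant_field chart_changeK//; case: (cB q).
have nE := lie_derivative_chart mB sf op pim ch.
have sD := smooth_on_derive w (sf p).
have nD : {near B p p, 'D_w (f \o param (B p)) =1
    lie_derivative B (constant_field B p w) f \o param (B p)}.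
  near=> x; have -> : (lie_derivative B (constant_field B p w) f \o param (B p)) x
      = 'd (f \o param (B p)) x w by apply/esym; near: x; exact: nE.
  rewrite deriveE//; apply: smooth_on_diff (sf p) _.
  by near: x; exact: open_nbhs_nbhs.
rewrite /hessian {1}/lie_derivative.
have -> : constant_field B p v p = v by exact: chart_changexx.
exact: near_eq_diff nD (smooth_on_diff sD pim).
Unshelve. all: by end_near. Qed.

Lemma hessian_linear p w : linear (fun v => hessian B f p v w : R^o).
Proof. by move=> a u v; rewrite !hessian_derive linearP. Qed.

(** In charts, f = Fq o tau near p. Differentiating twice gives the Hessian at [h p] on the image
    vectors plus a term pairing the first derivative of [Fq] with the second derivative of [tau];
    criticality of [h p] kills the latter. *)
Lemma hessian_tangent_map (h : M -> M) p v w :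
  smooth_map B B h -> (forall x, f (h x) = f x) ->
  critical_set B f (h p) ->
  hessian B f (h p) (tangent_map B B h p v) (tangent_map B B h p w) =
  hessian B f p v w.
Proof.
move=> sh fh crq; have [_ _ cB _] := mB; have [hp pp] := cB p.
have [hq qq] := cB (h p); have [_ opi pK _ _] := hp; have [_ oqi qK _ _] := hq.
rewrite !hessian_derive; set q := h p in crq hq qq oqi qK *.
set x0 := B p p; pose tau := B q \o h \o param (B p).
pose Fq := f \o param (B q).
have hp0 : h (param (B p) x0) = q by rewrite pK ?inE.
have tau0 : tau x0 = B q q by rewrite /tau /= hp0.
pose U := B p @` (dom (B p) `&` h @^-1` dom (B q)).
have oU : open U by apply: (open_chart_domain cB cB); have [] := sh.
have Ux0 : U x0 by exists p.
have st : smooth_on U tau by have [_] := sh; exact.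
have tauU x : U x -> (B q @` dom (B q)) (tau x).
  by move=> [y [py qy] <-]; rewrite /tau /= pK ?inE//; exists (h y).
have qim : (B q @` dom (B q)) (B q q) by exists q.
have FE x : U x -> (f \o param (B p)) x = (Fq \o tau) x.
  by move=> [y [py qy] <-]; rewrite /Fq /tau /= pK ?inE// qK ?inE// fh.
have dt0 : differentiable tau x0 by exact: smooth_on_diff st Ux0.
have dDq i : differentiable ('D_(delta_mx ord0 i) Fq) (B q q).
  exact: smooth_on_diff (smooth_on_derive _ (sf q)) qim.
pose P i := (fun x => 'D_w tau x ord0 i) * ('D_(delta_mx ord0 i) Fq \o tau).
pose dP i := 'D_w tau x0 ord0 i *:
  ('d ('D_(delta_mx ord0 i) Fq) (B q q) \o 'd tau x0 : _ -> _).
have dPi i : is_diff x0 (P i) (dP i).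
  have d1 : differentiable (fun x => 'D_w tau x ord0 i) x0.
    by have [d _] := k_differentiable_coord i oU (smooth_on_derive w st 1%N);
      exact: d.
  have d2 : is_diff x0 ('D_(delta_mx ord0 i) Fq \o tau)
      ('d ('D_(delta_mx ord0 i) Fq) (B q q) \o 'd tau x0).
    by apply: is_diff_comp; rewrite ?tau0; exact: differentiableP.
  have := is_diffM (differentiableP d1) d2.
  (* The factor in front of the second derivative of [tau]. *)
  have -> : ('D_(delta_mx ord0 i) Fq \o tau) x0 = 0.
    rewrite /= tau0 deriveE; first exact: crq.
    exact: smooth_on_diff (sf q) qim.
  by rewrite scale0r addr0.
have dS := is_diff_bigsum (index_enum 'I_n) dPi.
have [_ dE] : is_diff x0 ('D_w (f \o param (B p))) (\sum_i dP i).
  have [d1 dE] := dS; rewrite -dE; apply: near_eq_is_diff d1.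
  near=> x; have Ux : U x by near: x; exact: open_nbhs_nbhs.
  have dFq : differentiable Fq (tau x).
    by apply: smooth_on_diff (sf q) _; exact: tauU.
  have dt := smooth_on_diff st Ux.
  have -> : 'D_w (f \o param (B p)) x = 'D_w (Fq \o tau) x.
    apply: near_eq_derive; near=> y; apply: FE.
    by near: y; exact: open_nbhs_nbhs.
  rewrite [RHS]deriveE; last exact: differentiable_comp.
  rewrite (diff_compE _ erefl dt dFq) (diff_sum_partial _ dFq) fct_sumE.
  by apply: eq_bigr => i _; rewrite /P -(deriveE w dt).
apply: (@etrans _ _ ((\sum_i dP i) v)); last exact: (congr1 (@^~ v) (esym dE)).
set v' := tangent_map _ _ _ _ v; set w' := tangent_map _ _ _ _ w.
have w'E : w' = 'D_w tau x0 by rewrite (deriveE w dt0).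
pose L i := w' ord0 i *: ('d ('D_(delta_mx ord0 i) Fq) (B q q) : _ -> _).
have [d1 dE'] : is_diff (B q q)
    (\sum_i w' ord0 i *: 'D_(delta_mx ord0 i) Fq) (\sum_i L i).
  by apply: is_diff_bigsum => i; apply: is_diffZ; exact: differentiableP.
have [_ dE2] : is_diff (B q q) ('D_w' Fq) (\sum_i L i).
  rewrite -dE'; apply: near_eq_is_diff d1; near=> y.
  have dFq : differentiable Fq y.
    by apply: smooth_on_diff (sf q) _; near: y; exact: open_nbhs_nbhs.
  by rewrite (deriveE _ dFq) (diff_sum_partial _ dFq) fct_sumE.
apply: (@etrans _ _ ((\sum_i L i) v')); first exact: (congr1 (@^~ v') dE2).
by rewrite !fct_sumE; apply: eq_bigr => i _; rewrite /L /dP w'E.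
Unshelve. all: by end_near. Qed.

End Hessian.

(** * Smooth actions and local sections of orbit maps *)

Section ActionTangent.
Context {R : realType} (G : groupTopologicalType) (m : nat) (A : atlas R G m).
Context (M : topologicalType) (n : nat) (B : atlas R M n) (act : G -> M -> M).
Hypotheses (HG : lie_group A) (HM : smooth_manifold B).
Hypothesis (Hact : smooth_action A B act).

Let cA : charted A. Proof. by have [/charted_smooth_manifold] := HG. Qed.
Let cB : charted B. Proof. exact: charted_smooth_manifold. Qed.

Lemma act1 p : act 1%g p = p. Proof. by have [] := Hact. Qed.

Lemma actM a b p : act (a * b)%g p = act a (act b p).
Proof. by have [] := Hact. Qed.

Lemma actK a p : act a^-1%g (act a p) = p.
Proof. by rewrite -actM mulVg act1. Qed.

Lemma smooth_act a : smooth_map B B (act a).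
Proof. by have [_ _ sm] := Hact; exact: (smooth_map_partial_r cA cB cB sm a). Qed.

Lemma smooth_orbit_map p : smooth_map A B (fun a => act a p).
Proof. by have [_ _ sm] := Hact; exact: (smooth_map_partial_l cA cB cB sm p). Qed.

Lemma smooth_mulg a : smooth_map A A (fun b => a * b)%g.
Proof. by have [_ sm _] := HG; exact: (smooth_map_partial_r cA cA cA sm a). Qed.

Lemma smooth_mulgr a : smooth_map A A (fun b => b * a)%g.
Proof. by have [_ sm _] := HG; exact: (smooth_map_partial_l cA cA cA sm a). Qed.

Lemma tangent_act_mul a b p v :
  tangent_map B B (act (a * b)%g) p v =
  tangent_map B B (act a) (act b p) (tangent_map B B (act b) p v).
Proof.
have -> : act (a * b)%g = act a \o act b by apply/funext => q; rewrite /= actM.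
exact: (tangent_map_comp v erefl cB cB cB (smooth_act b) (smooth_act a)).
Qed.

Lemma tangent_act1 p v : tangent_map B B (act 1%g) p v = v.
Proof.
rewrite (_ : act 1%g = id); first exact: tangent_map_id.
by apply/funext => q; exact: act1.
Qed.

Lemma tangent_actK a p v :
  tangent_map B B (act a^-1%g) (act a p) (tangent_map B B (act a) p v) = v.
Proof. by rewrite -tangent_act_mul mulVg tangent_act1. Qed.

Lemma tangent_actVK a p v :
  tangent_map B B (act a) p (tangent_map B B (act a^-1%g) (act a p) v) = v.
Proof. by have := tangent_actK a^-1%g (act a p) v; rewrite invgK actK. Qed.

(** From a.(b.p) = (a b a^-1).(a.p): the differential of [act a] after that of the orbit map of p is
    that of the orbit map of a.p after conjugation by [a], split into its left and right
    translations. *)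
Lemma orbit_tangent_act a p u : orbit_tangent A B act p u ->
  orbit_tangent A B act (act a p) (tangent_map B B (act a) p u).
Proof.
move=> [w _ <-].
pose w1 := tangent_map A A (fun b => a * b)%g 1%g w.
have E1 := tangent_map_comp w (act1 p) cA cB cB (smooth_orbit_map p) (smooth_act a).
have E2 := tangent_map_comp w1 (mulgV a : (fun b => b * a^-1)%g a = 1%g)
  cA cA cB (smooth_mulgr a^-1%g)
  (smooth_orbit_map (act a p)).
have E3 := tangent_map_comp w (mulg1 a) cA cA cB (smooth_mulg a) (smooth_orbit_map p).
exists (tangent_map A A (fun b => b * a^-1)%g a w1) => //.
apply: eq_trans E1; rewrite -[LHS]E2.
have -> : (fun b => act b (act a p)) \o (fun b => b * a^-1)%g = fun b => act b p.
  by apply/funext => b; rewrite /= actM actK.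
rewrite /w1 -[LHS]E3.
have -> // : (fun b => act b p) \o (fun b => a * b)%g = act a \o (fun b => act b p).
by apply/funext => b; rewrite /= actM.
Qed.

Lemma orbit_map_continuous p : continuous (fun a => act a p).
Proof. by have [] := smooth_orbit_map p. Qed.

End ActionTangent.

Lemma affine_line_continuous (R : realType) (V : normedModType R) (a u : V) :
  continuous (fun t : R => a + t *: u).
Proof. by move=> t; apply: cvgD; [exact: cvg_cst|exact: scalel_continuous]. Qed.

Lemma chart_preimage_open (R : realType) (M : topologicalType) n
    (c : chart R M n) (V : set 'rV[R]_n) :
  is_chart c -> open V -> open (dom c `&` c @^-1` V).
Proof.
move=> [oc _ _ cc _] oV; rewrite openE => x [cx Vx].
apply: filterI; first exact: open_nbhs_nbhs.
exact: cc (mem_set cx) _ (open_nbhs_nbhs (conj oV Vx)).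
Qed.

Section LocalSection.
Context {R : realType} (G : groupTopologicalType) (m : nat) (A : atlas R G m).
Context (M : topologicalType) (n : nat) (B : atlas R M n) (act : G -> M -> M).
Hypotheses (HG : lie_group A) (HM : smooth_manifold B).
Hypothesis (Hact : smooth_action A B act).
Context (f : M -> R) (fGMB : G_morse_bott A B act f).
Context (p : M) (crp : Defs.orbit act p `<=` critical_set B f).

Let cA : charted A. Proof. by have [/charted_smooth_manifold] := HG. Qed.
Let cB : charted B. Proof. exact: charted_smooth_manifold. Qed.
Let C := connected_component (critical_set B f) p.
Let e0 : 'rV[R]_m := A 1%g 1%g.
Let pa (y : 'rV[R]_m) : G := param (A 1%g) y.

Let pe0 : pa e0 = 1%g.
Proof. by have [[_ _ AK _ _] d1] := cA 1%g; rewrite /pa AK ?inE. Qed.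

(** A ball in the chart at 1 is convex: a segment from the centre to [y] is carried by the orbit map
    to a connected set of critical points through p. *)
Lemma chart_ball_component : exists2 r : R, 0 < r &
  forall y : 'rV[R]_m, `|y - e0| < r ->
    (A 1%g @` dom (A 1%g)) y /\ C (act (pa y) p).
Proof.
have [[_ oi AK _ Ap] d1] := cA 1%g.
have : nbhs e0 (A 1%g @` dom (A 1%g)).
  by apply: open_nbhs_nbhs; split=> //; exists 1%g.
move=> /nbhs_ballP[r /= r0 rP]; exists r => // y yr.
have By z : `|z - e0| < r -> (A 1%g @` dom (A 1%g)) z.
  by move=> zr; apply: rP; rewrite -ball_normE /= distrC.
split; first exact: By.
pose l (t : R) := e0 + t *: (y - e0).
have lr t : 0 <= t <= 1 -> `|l t - e0| < r.
  move=> /andP[t0 t1]; rewrite /l addrC addKr normrZ ger0_norm//.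
  by apply: le_lt_trans yr; rewrite ler_piMl.
pose I := [set t : R | 0 <= t <= 1].
have II : I = `[0, 1]%classic by apply/seteqP; split=> t; rewrite /= in_itv.
pose g t := act (pa (l t)) p.
have cg : {within I, continuous g}.
  apply: continuous_in_subspaceT => t /set_mem It.
  apply: (@continuous_comp _ _ _ (pa \o l) (fun a => act a p)); last first.
    exact: (orbit_map_continuous HG HM Hact).
  apply: continuous_comp; last by apply: Ap; apply/mem_set/By/lr.
  exact: affine_line_continuous.
have I0 : I 0 by rewrite /I /= lexx ler01.
have I1 : I 1 by rewrite /I /= lexx ler01.
have cI : connected (g @` I).
  by apply: connected_continuous_connected cg; rewrite II; exact: segment_connected.
have g0 : g 0 = p by rewrite /g /l scale0r addr0 pe0 (act1 Hact).
apply: (@connected_component_max _ _ (g @` I)) => //.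
- by exists 0.
- by move=> _ [t _ <-]; apply: crp; exists (pa (l t)).
- by exists 1 => //; rewrite /g /l scale1r addrC subrK.
Qed.

Lemma near1_component : \forall a \near 1%g, C (act a p).
Proof.
have [r r0 rP] := chart_ball_component.
have [[oA oi AK Ac _] d1] := cA 1%g.
have n1 : \forall a \near 1%g, dom (A 1%g) a by exact: open_nbhs_nbhs.
have n2 : \forall a \near 1%g, `|A 1%g a - e0| < r.
  have /cvgrPdist_lt /(_ r r0) := Ac _ (mem_set d1).
  by apply: filterS => a; rewrite distrC.
near=> a; have da : dom (A 1%g) a by near: a.
have := rP (A 1%g a); rewrite /pa AK ?inE//.
by move=> H; apply: (H _).2; near: a.
Unshelve. all: by end_near. Qed.

(** This is where T_pC = T_p(G.p) makes the orbit map a submersion onto C. In the slice chart the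
    line through [c p] with direction [u] stays in C, so its velocity lies in T_pC, hence is the
    image of some [w] under the differential of the orbit map. *)
Lemma slice_tangent (c : chart R M n) k : is_chart c -> dom c p ->
  (forall q, smooth_transition c (B q) /\ smooth_transition (B q) c) ->
  (forall q, dom c q -> (C q <-> forall i : 'I_n, (k <= i)%N -> c q ord0 i = 0)) ->
  forall u : 'rV[R]_n, (forall i : 'I_n, (k <= i)%N -> u ord0 i = 0) ->
  exists w, 'd (c \o (fun a => act a p) \o param (A 1%g)) e0 w = u.
Proof.
move=> hc cp tr slice u uk; have [oc oci cK cc cpr] := hc.
have [hB pp] := cB p; have [oB oBi BK Bc Bpr] := hB.
have [sf invf mb orbt] := fGMB.
have crit_p : critical_set B f p by apply: crp; exists 1%g; rewrite ?(act1 Hact).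
have Cp : C p by exact: connected_component_refl.
have tE : tangent_space B C p = orbit_tangent A B act p by exact: orbt.
have ck (i : 'I_n) : (k <= i)%N -> c p ord0 i = 0 by apply: (slice p cp).1.
pose D := c @` (dom c `&` dom (B p)).
have oD : open D by exact: chart_image_open.
have Dp : D (c p) by exists p.
have [r /= r0 rP] : exists2 r : R, 0 < r & forall t : R, `|t| < r ->
    D (c p + t *: u).
  have : \forall t \near (0 : R), D (c p + t *: u).
    have cl : {for (0 : R), continuous (fun t : R => c p + t *: u)}.
      exact: affine_line_continuous.
    apply: cl; apply: open_nbhs_nbhs; split=> //.
    by rewrite scale0r addr0.
  move=> /nbhs_ballP[r /= r0 rP]; exists r => // t tr'.
  by apply: rP; rewrite -ball_normE /= sub0r normrN.
pose g t := param c (c p + t *: u).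
have gE t : `|t| < r -> [/\ dom c (g t), dom (B p) (g t) & c (g t) = c p + t *: u].
  by move=> /rP[x [cx Bx] xE]; rewrite /g -xE cK ?inE.
pose It := [set t : R | `|t| < r].
have oIt : open It.
  rewrite (_ : It = ball (0 : R) r); first exact: ball_open.
  by apply/seteqP; split=> t; rewrite -ball_normE /= sub0r normrN.
have saff : smooth_on It (fun t : R => c p + t *: u).
  move=> j; apply: (@k_differentiableD _ _ _ j _ (cst (c p)) (fun t : R => t *: u)) => //.
    exact: k_differentiable_cst.
  apply: (@k_differentiable_linear _ R^o R^o _ j It (fun t => t *: u) id) => //.
  - by move=> a x y; rewrite scalerDl scalerA.
  - exact: scalel_continuous.
  - exact: k_differentiable_id.
have sBg : smooth_on It (B p \o g).
  move=> j; apply: (@k_differentiable_comp _ _ _ _ j It D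
    (fun t : R => c p + t *: u) (B p \o param c)) => //.
  exact: (tr p).1.
have dtr : differentiable (B p \o param c) (c p).
  exact: smooth_on_diff (tr p).1 Dp.
pose v := 'd (B p \o param c) (c p) u.
have gv : 'D_1 (B p \o g) 0 = v.
  have d0 : It 0 by rewrite /It /= normr0.
  rewrite deriveE; last exact: smooth_on_diff sBg d0.
  have dl := smooth_on_diff saff d0.
  have lE : (fun t : R => c p + t *: u) 0 = c p by rewrite scale0r addr0.
  apply: eq_trans (@diff_compE _ _ _ _ (fun t : R => c p + t *: u)
    (B p \o param c) 0 _ 1 lE dl dtr) _.
  rewrite /v; congr ('d _ _ _).
  have [_ dE] := is_diffD (is_diff_cst (c p) (0 : R)) (is_diff_scalel 0 u).
  by apply: eq_trans (congr1 (@^~ 1) dE) _; rewrite /GRing.add/= add0r scale1r.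
have : tangent_space B C p v.
  exists g, r; split=> //; first by rewrite /g scale0r addr0 cK ?inE.
  move=> t /gE[gc gB gE']; split=> //; apply/(slice _ gc) => i ki.
  by rewrite gE' !mxE ck// uk// mulr0 addr0.
rewrite tE => -[w _ wE]; exists w.
have so := smooth_orbit_map HG HM Hact p.
have d1 : dom (A 1%g) 1%g by case: (cA 1%g).
have a1 : (fun a => act a p) (pa e0) = p by rewrite pe0 (act1 Hact).
have Bp1 : dom (B p) (act 1%g p) by rewrite (act1 Hact).
have dcB : differentiable (c \o param (B p)) (B p p).
  by apply: smooth_on_diff (tr p).2 _; exists p.
have := @diff_through_chart _ _ _ _ _ (B p) ((fun a => act a p) \o param (A 1%g))
  c e0 w hB.
rewrite /= a1 => ->//; last 2 first.
- by have [co _] := so; exact: (near_chart_map cA co oB d1 Bp1).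
- exact: (smooth_map_diff so d1 Bp1).
have -> : 'd (B p \o ((fun a => act a p) \o param (A 1%g))) e0 w = v.
  by move: wE; rewrite /tangent_map (act1 Hact).
have ncB : \forall x \near c p, dom (B p) (param c x).
  near=> x; have [y [dy By <-]] : exists y, [/\ dom c y, dom (B p) y & c y = x].
    by near: x; apply: near_chart => //; exact: open_nbhs_nbhs.
  by rewrite cK ?inE.
have ncc : {near c p, id =1 c \o param c}.
  near=> x; have [y [dy _ <-]] : exists y, [/\ dom c y, setT y & c y = x].
    by near: x; apply: near_chart => //; exact: filterT.
  by rewrite /= cK ?inE.
have Bpc : B p (param c (c p)) = B p p by rewrite cK ?inE.
have H := @diff_through_chart _ _ _ _ _ (B p) (param c) c (c p) u hB ncB dtr.
rewrite Bpc in H; apply: eq_trans (esym (H dcB)) _.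
apply: eq_trans (near_eq_diff u ncc _) _; first exact: ex_diff.
by rewrite diff_val.
Unshelve. all: by end_near. Qed.

(** The map [s] is defined on an open set of the ambient chart, in the form that
    [smooth_field_along] asks for, but the section equation holds only on C, where the coordinates
    from [k] on vanish. *)
Lemma local_section : exists (V : set 'rV[R]_n) (s : 'rV[R]_n -> 'rV[R]_m),
  [/\ open V, V (B p p), smooth_on V s,
    forall x, V x -> (A 1%g @` dom (A 1%g)) (s x) &
    forall q, C q -> dom (B p) q -> V (B p q) ->
      act (param (A 1%g) (s (B p q))) p = q].
Proof.
have [hB pp] := cB p; have [oB oBi BK Bc Bpr] := hB.
have [[oA oAi AK Ac Apr] d1] := cA 1%g.
have [_ _ mb _] := fGMB.
have crit_p : critical_set B f p by apply: crp; exists 1%g; rewrite ?(act1 Hact).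
have Cp : C p by exact: connected_component_refl.
have [[k sub] _] := mb p crit_p.
have [c [hc cp tr slice]] := sub p Cp; have [oc oci cK cc cpr] := hc.
pose om := c \o (fun a => act a p) \o param (A 1%g).
have [r r0 rP] := chart_ball_component.
have so := smooth_orbit_map HG HM Hact p; have [co _] := so.
pose D := A 1%g @` (dom (A 1%g) `&` (fun a => act a p) @^-1` (dom (B p) `&` dom c)).
have oD : open D.
  apply: chart_image_open; first by case: (cA 1%g).
  by apply: open_comp; [move=> x _; exact: co|exact: openI].
have De0 : D e0 by exists 1%g => //; split=> //=; rewrite (act1 Hact).
have som : smooth_on D om := smooth_map_smooth_chart cA cB 1%g so hc (tr p).2.
have pAe0 : param (A 1%g) e0 = 1%g by rewrite AK ?inE.
have om0 : om e0 = c p by rewrite /om /= pAe0 (act1 Hact).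
have [w wP] : {w : 'I_n -> 'rV[R]_m & forall i : 'I_n, (i < k)%N ->
    'd om e0 (w i) = delta_mx ord0 i}.
  apply: (@choice _ _ (fun (i : 'I_n) (w : 'rV[R]_m) =>
    (i < k)%N -> 'd om e0 w = delta_mx ord0 i)) => i.
  have [ik|ki] := ltnP i k; last by exists 0.
  have [j kj|v vE] := slice_tangent hc cp tr slice (u := delta_mx ord0 i);
    last by exists v.
  by rewrite mxE eqxx /=; case: eqP => // ji; move: kj; rewrite ji leqNgt ik.
(* The first [k] rows are lifts of the basis vectors through the differential of the orbit map; the
   other directions are left to [Q]. *)
pose La : 'M[R]_(n, m) := \matrix_i (if (i < k)%N then w i else 0).
pose Q (x : 'rV[R]_n) : 'rV[R]_n := \row_i (if (i < k)%N then 0 else x ord0 i).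
have lQ : linear Q.
  by move=> a u v; apply/rowP => i; rewrite !mxE; case: ifP => // _; rewrite mulr0 addr0.
pose aff (x : 'rV[R]_n) : 'rV[R]_m := e0 + x *m La.
have saff (U : set 'rV[R]_n) : open U -> smooth_on U aff.
  move=> oU j; apply: (@k_differentiableD _ _ _ j _ (cst e0) (mulmx ^~ La)) => //.
    exact: k_differentiable_cst.
  by apply: (smooth_linear_rV oU) => a u v; rewrite mulmxDl scalemxAl.
(* The ball of radius [r] ensures that the orbit map takes values in C. *)
pose U := aff @^-1` (D `&` ball e0 r).
have oU : open U.
  apply: open_comp; last by apply: openI => //; exact: ball_open.
  move=> x _; apply: differentiable_continuous.
  exact: smooth_on_diff (saff _ openT) I.
have aff0 : aff 0 = e0 by rewrite /aff mul0mx addr0.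
have U0 : U 0 by rewrite /U /= aff0; split=> //; exact: ballxx.
(* Adding the last coordinates Q x makes the orbit map, read in the slice chart,
   a map between spaces of the same dimension, with derivative the identity at 0. *)
pose Th (x : 'rV[R]_n) := om (aff x) + Q x.
have spa : smooth_on U (om \o aff).
  by move=> j; apply: (k_differentiable_comp oU oD _ (saff _ oU j) (som j)) => x [].
have sTh : smooth_on U Th.
  move=> j; apply: (@k_differentiableD _ _ _ j _ (om \o aff) Q) => //.
  exact: (smooth_linear_rV oU lQ).
have dTh v : 'd Th 0 v = v.
  have dpi : differentiable om e0 by exact: smooth_on_diff som De0.
  have daff := smooth_on_diff (saff _ openT) (I : setT (0 : 'rV[R]_n)).
  have lLa : linear (mulmx ^~ La : 'rV[R]_n -> 'rV[R]_m).
    by move=> a u u'; rewrite mulmxDl scalemxAl.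
  have [dLa LaE] := diff_linear_rV 0 lLa.
  have [dQ QE] := diff_linear_rV 0 lQ.
  have affE : 'd aff 0 v = v *m La.
    have [_ dE] := is_diffD (is_diff_cst e0 (0 : 'rV[R]_n)) (differentiableP dLa).
    apply: eq_trans (congr1 (@^~ v) dE) _.
    by rewrite LaE /GRing.add/= add0r.
  have dpa : differentiable (om \o aff) 0 by exact: smooth_on_diff spa U0.
  have [_ dE] := is_diffD (differentiableP dpa) (differentiableP dQ).
  apply: eq_trans (congr1 (@^~ v) dE) _.
  have E1 : 'd Q 0 v = Q v := congr1 (@^~ v) QE.
  have E2 : 'd (om \o aff) 0 v = 'd om e0 (v *m La).
    exact: eq_trans (diff_compE v aff0 daff dpi) (congr1 _ affE).
  apply: (eq_trans (congr2 +%R E2 E1)).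
  have -> : v *m La = \sum_(i < n) v ord0 i *: (if (i < k)%N then w i else 0).
    rewrite mulmx_sum_row; apply: eq_bigr => i _; congr (_ *: _).
    by apply/rowP => j; rewrite !mxE.
  rewrite linear_sum; apply/rowP => j; rewrite !mxE summxE (bigD1 j)//= big1 => [|i ij].
    rewrite linearZ /= !mxE; case: ifP => jk; last first.
      by rewrite linear0 mxE mulr0 addr0 add0r.
    by rewrite wP// mxE !eqxx mulr1 !addr0.
  rewrite linearZ /= mxE; case: ifP => ik; last by rewrite linear0 mxE mulr0.
  by rewrite wP// mxE eqxx/= eq_sym (negbTE ij) mulr0.
have [V0 [S [oV0 V0p sS SP]]] := smooth_right_inverse oU U0 sTh dTh.
have Th0 : Th 0 = c p.
  rewrite /Th aff0 om0; suff -> : Q 0 = 0 by rewrite addr0.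
  by apply/rowP => i; rewrite !mxE; case: ifP.
rewrite Th0 in V0p.
pose V := B p @` (dom (B p) `&` (dom c `&` c @^-1` V0)).
have oV : open V by apply: chart_image_open => //; exact: chart_preimage_open.
have scB : smooth_on V (c \o param (B p)).
  by apply: smooth_on_subset (tr p).2 => _ [x [Bx [cx _]] <-]; exists x.
have VV0 x : V x -> V0 ((c \o param (B p)) x).
  by move=> [y [By [cy Vy]] <-]; rewrite /= BK ?inE.
exists V, (aff \o S \o (c \o param (B p))); split=> //.
- by exists p.
- move=> j; apply: (k_differentiable_comp oV oV0 VV0 (scB j)).
  apply: (k_differentiable_comp oV0 oU _ (sS j) (saff _ oU j)).
  by move=> y /SP[].
- move=> x /VV0/SP[[[a [da _] aE] _] _]; by exists a.
move=> q Cq Bq [q' [Bq' [cq' Vq']] qq'].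
have qE : q' = q by rewrite -(BK q') ?inE// qq' BK ?inE.
rewrite {}qE {q' qq'} in Bq' cq' Vq' *.
have [[[a [da [Ba ca]] aE] br] ThE] := SP _ Vq'.
rewrite /= BK ?inE//; set x := S (c q) in ThE aE br *.
have Ca : C (act (param (A 1%g) (aff x)) p).
  by apply: (rP _ _).2; move: br; rewrite -ball_normE /= distrC.
have paE : param (A 1%g) (aff x) = a by rewrite -aE AK ?inE.
rewrite paE in Ca *.
have piE : om (aff x) = c (act a p) by rewrite /om /= paE.
(* The points q and a.p both lie in C, so [c q] and [om (aff x)] have zero coordinates from [k] on;
   their difference [Q x] is supported there. *)
have Qx : Q x = 0.
  apply/rowP => i; rewrite [LHS]mxE [RHS]mxE; case: ltnP => // ki.
  have := congr1 (fun z : 'rV[R]_n => z ord0 i) ThE.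
  rewrite ((slice _ cq').1 Cq)// /Th piE !mxE ((slice _ ca).1 Ca)//.
  by rewrite ltnNge ki /= add0r.
have : c (act a p) = c q by rewrite -ThE /Th Qx addr0 piE.
by move=> /(congr1 (param c)); rewrite !cK ?inE.
Qed.

End LocalSection.

(** * Critical orbits and components of the critical set *)

Section OrbitComponent.
Context {R : realType} (G : groupTopologicalType) (m : nat) (A : atlas R G m).
Context (M : topologicalType) (n : nat) (B : atlas R M n) (act : G -> M -> M).
Hypotheses (HG : lie_group A) (HM : smooth_manifold B).
Hypothesis (Hact : smooth_action A B act) (Gcompact : compact [set: G]).
Context (f : M -> R) (fGMB : G_morse_bott A B act f).

Let C p := connected_component (critical_set B f) p.

Lemma orbit_image_closed (K : set G) p : closed K ->
  closed ((fun a => act a p) @` K).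
Proof.
move=> cK; have [hM _ _ _] := HM; apply: compact_closed => //.
apply: continuous_compact; last exact: subclosed_compact cK Gcompact _.
by apply: continuous_subspaceT; exact: (orbit_map_continuous HG HM Hact).
Qed.

Lemma orbit_act a p : Defs.orbit act (act a p) = Defs.orbit act p.
Proof.
apply/seteqP; split=> [_ [b _ <-]|_ [b _ <-]].
  by exists (b * a)%g => //; rewrite (actM Hact).
by exists (b * a^-1)%g => //; rewrite (actM Hact) (actK Hact).
Qed.

(** The trace of the orbit on C is open in C by the local sections at its points, and closed because
    orbits are compact. It is nonempty, so it is all of the connected set C. *)
Lemma component_sub_orbit p : Defs.orbit act p `<=` critical_set B f ->
  C p `<=` Defs.orbit act p.
Proof.
move=> crp; have op : Defs.orbit act p p by exists 1%g; rewrite ?(act1 Hact).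
have Cp : C p p by exact/connected_component_refl/crp.
suff : C p `&` Defs.orbit act p = C p by move=> <- x [].
apply: (@component_connected _ (critical_set B f) p).
- by exists p.
- exists (\bigcup_(W in [set W | open W /\ C p `&` W `<=` Defs.orbit act p]) W).
    by apply: bigcup_open => W [].
  apply/seteqP; split=> [x [Cx ox]|x [Cx [W [_ sW] Wx]]]; last first.
    by split=> //; exact: sW.
  split=> //; have oxp : Defs.orbit act x = Defs.orbit act p.
    by case: ox => a _ <-; exact: orbit_act.
  have crx : Defs.orbit act x `<=` critical_set B f by rewrite oxp.
  have [V [s [oV Vx _ _ sP]]] := local_section HG HM Hact fGMB crx.
  have [_ _ cB _] := HM; have [hB xx] := cB x.
  exists (dom (B x) `&` B x @^-1` V); last by [].
  split=> [|q [Cq [Bq Vq]]]; first exact: chart_preimage_open.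
  rewrite -oxp -(sP q) //; first by eexists.
  by rewrite /= -(same_connected_component Cx).
- exists (Defs.orbit act p) => //; apply: orbit_image_closed.
  exact: closedT.
Qed.

(** Group elements far from 1 could bring points of other components arbitrarily close to p;
    compactness of [G] rules this out. *)
Lemma orbit_near_component p : Defs.orbit act p `<=` critical_set B f ->
  exists W : set M, [/\ open W, W p & Defs.orbit act p `&` W `<=` C p].
Proof.
move=> crp; have N1 := near1_component HG HM Hact crp.
pose N := [set a | C p (act a p)]°.
(* G \ P is compact, so that its image under the orbit map is closed, and this
   image does not contain p. *)
pose P := [set b | exists2 a, N a & act b p = act a p].
have oP : open P.
  (* [P] is the product of [N] with the stabilizer of p: [h] fixes p and b h^-1 = a lies in [N], so
     openness is carried to b by a right translation. *)
  rewrite openE => b [a Na ba]; pose h := (a^-1 * b)%g.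
  have hp : act h p = p by rewrite /h (actM Hact) ba (actK Hact).
  have hV : act h^-1%g p = p by rewrite -[in LHS]hp (actK Hact).
  have [cm _] := smooth_mulgr HG h^-1%g.
  have nb : nbhs (b * h^-1)%g N.
    apply: open_nbhs_nbhs; split; first exact: open_interior.
    by rewrite /h invgM invgK mulVKg.
  have {nb} : nbhs b (fun b' => N (b' * h^-1)%g) by exact: cm b _ nb.
  rewrite /interior; apply: filterS => b' Nb'.
  by exists (b' * h^-1)%g => //; rewrite (actM Hact) hV.
exists (~` ((fun a => act a p) @` (~` P))); split.
- by apply: closed_openC; apply: orbit_image_closed; exact: open_closedC.
- move=> [b nPb bp]; apply: nPb; exists 1%g; first exact: N1.
  by rewrite bp (act1 Hact).
- move=> _ [[b _ <-] nb].
  have [a Na ->] : P b by apply: contrapT => nP; apply: nb; exists b.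
  exact: interior_subset Na.
Qed.

End OrbitComponent.

(** * Averaging over a stabilizer *)

Section BorelGroup.
Context {R : realType} (G : groupTopologicalType).

Lemma open_borel (U : set G) : open U -> measurable (U : set (borel G)).
Proof. by move=> oU; exact: sub_sigma_algebra. Qed.

Lemma closed_borel (U : set G) : closed U -> measurable (U : set (borel G)).
Proof.
move=> cU; rewrite -[U]setCK; apply: (@measurableC _ (borel G)).
by apply: open_borel; exact: closed_openC.
Qed.

Lemma within_continuous_borel (K : set G) (f : G -> R) :
  closed K -> {within K, continuous f} ->
  measurable_fun (K : set (borel G)) (f : borel G -> R).
Proof.
move=> cK /continuousP cf.
apply: (measurability _ (measurable_realfun.RGenOpens.measurableE R)).
move=> _ [_ [a [b ->] <-]].
have : open (f @^-1` `]a, b[%classic : set (subspace K)).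
  exact/cf/interval_open.
move=> /open_subspaceP[V oV VE].
rewrite setIC -VE; apply: (@measurableI _ (borel G)); first exact: open_borel.
exact: closed_borel.
Qed.

Lemma continuous_borel (h : G -> G) : continuous h ->
  measurable_fun [set: borel G] (h : borel G -> borel G).
Proof.
move=> /continuousP ch.
apply: (@measurability _ _ (borel G) (borel G) setT h (@open G)) => //.
by move=> _ [U oU <-]; rewrite setTI; apply: open_borel; exact: ch.
Qed.

End BorelGroup.

Lemma Rintegral_linear (R : realType) d (T : measurableType d)
    (mu : {measure set T -> \bar R}) (D : set T) n (psi : T -> 'rV[R]_n)
    (l : 'rV[R]_n -> R^o) :
  measurable D -> linear l ->
  (forall i, mu.-integrable D (EFin \o (fun x => psi x ord0 i))) ->
  Rintegral mu D (l \o psi) = l (\row_i Rintegral mu D (fun x => psi x ord0 i)).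
Proof.
move=> mD ll ipsi.
have lE v : l v = \sum_(i < n) l (delta_mx ord0 i) * v ord0 i.
  pose LL := GRing.isLinear.Build R 'rV[R]_n R^o _ l ll.
  pose L' : {linear 'rV[R]_n -> R^o} := HB.pack l LL.
  rewrite -[LHS]/(L' v) [in LHS](row_sum_delta v) linear_sum.
  by apply: eq_bigr => i _; rewrite linearZ mulrC.
have sumE (s : seq 'I_n) :
    mu.-integrable D (EFin \o
      (fun x => \sum_(i <- s) l (delta_mx ord0 i) * psi x ord0 i)) /\
    Rintegral mu D (fun x => \sum_(i <- s) l (delta_mx ord0 i) * psi x ord0 i) =
    \sum_(i <- s) l (delta_mx ord0 i) * Rintegral mu D (fun x => psi x ord0 i).
  elim: s => [|i s [IH1 IH2]].
    rewrite (_ : (fun x => _) = cst 0); last by apply/funext => x; rewrite big_nil.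
    by split; [exact: integrable0|rewrite Rintegral_cst// mul0r big_nil].
  have E : (fun x => \sum_(j <- i :: s) l (delta_mx ord0 j) * psi x ord0 j) =
      (fun x => l (delta_mx ord0 i) * psi x ord0 i +
        \sum_(j <- s) l (delta_mx ord0 j) * psi x ord0 j).
    by apply/funext => x; rewrite big_cons.
  have i1 : mu.-integrable D (EFin \o (fun x => l (delta_mx ord0 i) * psi x ord0 i)).
    exact: (integrableZl mD _ (ipsi i)).
  rewrite E; split; first exact: (integrableD mD i1 IH1).
  by rewrite RintegralD// RintegralZl// IH2 big_cons.
rewrite lE.
have -> : l \o psi = fun x => \sum_(i < n) l (delta_mx ord0 i) * psi x ord0 i.
  by apply/funext => x; rewrite /= lE.
by rewrite (sumE _).2; apply: eq_bigr => i _; rewrite mxE.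
Qed.

Section Averaging.
Context {R : realType} (G : groupTopologicalType) (m : nat) (A : atlas R G m).
Context (M : topologicalType) (n : nat) (B : atlas R M n) (act : G -> M -> M).
Hypotheses (HG : lie_group A) (HM : smooth_manifold B).
Hypothesis (Hact : smooth_action A B act) (Gcompact : compact [set: G]).
Context (q : M) (mu : probability (borel G) R).

Let cA : charted A. Proof. by have [/charted_smooth_manifold] := HG. Qed.
Let cB : charted B. Proof. exact: charted_smooth_manifold. Qed.
Let H := Defs.stabilizer act q.
Let T a v := tangent_map B B (act a) q v.

Lemma stabilizer_closed : closed H.
Proof.
have [hM _ _ _] := HM.
have -> : H = (fun a => act a q) @^-1` [set q] by apply/seteqP; split.
apply: closed_comp; first by move=> x _; exact: (orbit_map_continuous HG HM Hact).
exact/accessible_closed_set1/hausdorff_accessible.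
Qed.

Lemma stabilizer_measurable : measurable (H : set (borel G)).
Proof. by apply: closed_borel; exact: stabilizer_closed. Qed.

Lemma stabilizerM h a : H h -> H (h * a)%g <-> H a.
Proof.
move=> Hh; rewrite /H /Defs.stabilizer /= (actM Hact); split=> [e|->//].
by rewrite -[LHS](actK Hact h) e -[in LHS]Hh (actK Hact).
Qed.

Lemma stabilizerV h : H h -> H h^-1%g.
Proof. by move=> Hh; rewrite /H /Defs.stabilizer /= -{1}Hh (actK Hact). Qed.

(** Tangent vectors at a.q are read in the chart [B (act a q)], which may jump with [a]. On [H] the
    target is always q, the chart is fixed, and the entry is a directional derivative of the joint
    smooth map. *)
Lemma stabilizer_tangent_continuous v i :
  {within H, continuous (fun a => T a v ord0 i)}.
Proof.
have [_ _ sF] := Hact; apply/subspace_continuousP => a0 Ha0.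
have [[oA _ _ Ac _] da0] := cA a0; have [_ qq] := cB q.
pose F (z : G * M) := act z.1 z.2.
pose J := B q \o F \o param (prod_atlas A B (a0, q)).
pose g a := 'D_(row_mx 0 v) J (row_mx (A a0 a) (B q q)) ord0 i.
have TE a : H a -> dom (A a0) a -> T a v ord0 i = g a.
  move=> Ha da; have qa : dom (B q) (F (a, q)) by rewrite /F /= Ha.
  rewrite /g -(diff_partial_r cA cB sF v da qa) /T /tangent_map.
  by rewrite (Ha : act a q = q).
have cg : {for a0, continuous g}.
  apply: (@continuous_comp _ _ _ (fun a => 'D_(row_mx 0 v) J (row_mx (A a0 a) (B q q)))
    (fun z : 'rV[R]_n => z ord0 i)); last exact: coord_continuous.
  apply: (@continuous_comp _ _ _ (fun a => row_mx (A a0 a) (B q q)) ('D_(row_mx 0 v) J)).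
    apply: row_mx_continuous; last exact: cst_continuous.
    exact/Ac/mem_set.
  apply: differentiable_continuous.
  have [_ sJ] := sF; apply: smooth_on_diff (smooth_on_derive _ (sJ (a0, q) q)) _.
  by apply: joint_dom => //; rewrite /= Ha0.
have key : (fun a => T a v ord0 i) @ within H (nbhs a0) --> g a0.
  apply: (@cvg_trans _ (g @ within H (nbhs a0))).
    apply: near_eq_cvg; rewrite near_withinE; near=> a => Ha.
    by apply/esym/TE => //; near: a; exact: open_nbhs_nbhs.
  exact: cvg_within_filter.
exact: (eq_ind_r (fun z => (fun a => T a v ord0 i) @ within H (nbhs a0) --> z)
  key (TE a0 Ha0 da0)).
Unshelve. all: by end_near. Qed.

Lemma within_continuous_integrable (u : G -> R) : {within H, continuous u} ->
  mu.-integrable (H : set (borel G)) (EFin \o u : borel G -> \bar R).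
Proof.
move=> cu; apply: measurable_bounded_integrable.
- exact: stabilizer_measurable.
- apply: le_lt_trans (ltry 1); rewrite -(@probability_setT _ (borel G) R mu).
  by apply: le_measure; rewrite ?inE//; exact: stabilizer_measurable.
- by apply: within_continuous_borel => //; exact: stabilizer_closed.
- have cH : compact H by exact: subclosed_compact stabilizer_closed Gcompact _.
  have /compact_bounded[N [_ Nu]] := continuous_compact cu cH.
  by exists N; split; rewrite ?num_real // => x Nx a Ha; apply: Nu => //; exists a.
Qed.

Hypothesis haar : haar_measure (Defs.stabilizer act q) mu.

(** Invariance is given for sets; it says that left translation by [h] pushes [mu] to itself, and
    the change of variables formula transfers it to integrals. *)
Lemma haar_Rintegral h (u : G -> R) : H h -> {within H, continuous u} ->
  Rintegral mu H (fun a => u (h * a)%g) = Rintegral mu H u.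
Proof.
move=> Hh cu; have mH := stabilizer_measurable.
pose L (a : borel G) : borel G := (h * a)%g.
have mL : measurable_fun [set: borel G] L.
  by apply: continuous_borel; have [] := smooth_mulg HG h.
have LH : L @^-1` H = H.
  by apply/seteqP; split=> a; rewrite /L /preimage /= => Ha; exact/(stabilizerM a Hh).
(* Extension by zero: [u] is controlled only on [H], and a measurable function on all of [G] is
   wanted. *)
pose uH : borel G -> \bar R := (EFin \o u) \_ H.
have iu := within_continuous_integrable cu.
have muH : measurable_fun [set: borel G] uH.
  by have /integrableP[mu' _] := iu; exact/(measurable_restrictT _ _).1.
have cuL : {within H, continuous (fun a => u (h * a)%g)}.
  apply/subspace_continuousP => a Ha; move/subspace_continuousP : cu => cu.
  have HhA : H (h * a)%g by exact/(stabilizerM a Hh).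
  apply: cvg_trans (cu _ HhA).
  have [cm _] := smooth_mulg HG h.
  move=> P nP.
  have {}nP : nbhs (h * a)%g (fun x => H x -> P (u x)) by exact: nP.
  have nP' : nbhs a (fun b => H (h * b)%g -> P (u (h * b)%g)) by exact: cm a _ nP.
  suff : nbhs a (fun b => H b -> P (u (h * b)%g)) by [].
  by apply: filterS nP' => b Pb Hb; apply: Pb; exact/(stabilizerM b Hh).
have iuL : mu.-integrable (L @^-1` H) (uH \o L).
  rewrite LH; apply: eq_integrable (within_continuous_integrable cuL) => // a.
  rewrite inE => Ha; rewrite /uH /= patchE mem_set//.
  exact/(stabilizerM a Hh).
have := integral_pushforward mL muH iuL mH.
rewrite LH (eq_measure_integral mu) => [E|E mE _]; last first.
  rewrite /pushforward; have [_ inv] := haar.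
  rewrite -[RHS](inv _ _ (stabilizerV Hh) mE); congr (mu _).
  apply/seteqP; split=> [a La|_ [a Ea <-]].
    by exists (h * a)%g => //; rewrite mulKg.
  by rewrite /L /preimage /= mulVKg.
rewrite /Rintegral; congr fine; apply/esym.
have -> : (\int[mu]_(x in H) (u x)%:E)%E = (\int[mu]_(y in H) uH y)%E.
  apply: eq_integral => a Ha; by rewrite /uH patchE Ha.
rewrite E; apply: eq_integral => a; rewrite inE => Ha.
rewrite /uH /= patchE mem_set//.
exact/(stabilizerM a Hh).
Qed.

Let average := average B act mu.

(** Thus any linear equation satisfied by all the translates [T a v] passes to the average. *)
Lemma average_linear (l : 'rV[R]_n -> R^o) v : linear l ->
  l (average q v) = Rintegral mu H (fun a => l (T a v)).
Proof.
move=> ll; apply/esym; apply: (@Rintegral_linear _ _ (borel G) mu H n (T ^~ v) l) => //.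
  exact: stabilizer_measurable.
by move=> i; exact: within_continuous_integrable (@stabilizer_tangent_continuous v i).
Qed.

Lemma tangent_average h v : H h -> T h (average q v) = average q v.
Proof.
move=> Hh; apply/rowP => j; rewrite [RHS]mxE.
have ll : linear (fun x => T h x ord0 j : R^o).
  by move=> a x y; rewrite /T tangent_map_linear !mxE.
apply: (eq_trans (average_linear v ll)).
rewrite -(haar_Rintegral Hh (@stabilizer_tangent_continuous v j)).
apply: eq_Rintegral => a; rewrite inE => Ha.
have E := tangent_act_mul HG HM Hact h a q v.
rewrite (Ha : act a q = q) in E.
exact: (congr1 (fun w : 'rV[R]_n => w ord0 j) (esym E)).
Qed.

Lemma average_fixed v : (forall h, H h -> T h v = v) -> average q v = v.
Proof.
move=> Tv; apply/rowP => j; rewrite mxE.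
have -> : Rintegral mu H (fun h => T h v ord0 j) =
    Rintegral mu H (fun h => v ord0 j).
  by apply: eq_Rintegral => h; rewrite inE => Hh; rewrite Tv.
rewrite Rintegral_cst; last exact: stabilizer_measurable.
rewrite -[RHS]mulr1.
exact: (congr1 (fun z => v ord0 j * fine z) haar.1).
Qed.

Lemma average_is_linear : linear (average q).
Proof.
move=> a x y; apply/rowP => j; rewrite !mxE.
have mH := stabilizer_measurable.
have ix v := within_continuous_integrable (@stabilizer_tangent_continuous v j).
have E1 := RintegralZl a mH (ix x).
have E2 := RintegralD mH (integrableZl mH a (ix x)) (ix y).
apply: eq_trans (eq_trans E2 (congr1 (+%R^~ _) E1)).
by apply: eq_Rintegral => h _; rewrite tangent_map_linear !mxE.
Qed.

(** The average takes values in the fixed vectors and fixes those, as [mu H = 1]: it is a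
    projection, and v - average v lies in its kernel. *)
Lemma average_sub v : average q (v - average q v) = 0.
Proof.
have E := average_is_linear (-1) (average q v) v.
rewrite scaleN1r in E; rewrite [v - _]addrC E scaleN1r average_fixed ?addNr//.
by move=> h; exact: tangent_average.
Qed.

End Averaging.

(** * Negative normal spaces *)

Lemma linear_fun0 (K : ringType) (U V : lmodType K) (F : U -> V) :
  linear F -> F 0 = 0.
Proof. by move=> lF; have := lF (-1) 0 0; rewrite scaler0 addr0 scaleN1r addNr. Qed.

Lemma linear_funZ (K : ringType) (U V : lmodType K) (F : U -> V) a u :
  linear F -> F (a *: u) = a *: F u.
Proof. by move=> lF; have := lF a u 0; rewrite addr0 (linear_fun0 lF) addr0. Qed.

Lemma linear_set_row_space (K : fieldType) n (E : set 'rV[K]_n) :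
  E 0 -> (forall a u v, E u -> E v -> E (a *: u + v)) ->
  exists k (X : 'M[K]_(k, n)), row_free X /\ range (mulmx ^~ X) = E.
Proof.
move=> E0 EL.
(* Ranks of matrices whose row space lies in [E]. At the maximal rank, adjoining a vector of [E]
   cannot enlarge the row space, which is therefore [E]. *)
pose P r := `[< exists X : 'M[K]_n, \rank X = r /\ forall x : 'rV_n, E (x *m X) >].
have P0 : exists r, P r.
  by exists 0%N; apply/asboolP; exists 0; rewrite mxrank0; split=> // x; rewrite mulmx0.
have Pn r : P r -> (r <= n)%N by move=> /asboolP[X [<- _]]; exact: rank_leq_row.
case: (ex_maxnP P0 Pn) => r /asboolP[X [rX EX]] rmax.
exists (\rank X), (row_base X); split; first exact: row_base_free.
apply/seteqP; split=> [_ [x _ <-]|v Ev].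
  have /submxP[y ->] : (x *m row_base X <= X)%MS.
    by rewrite (submx_trans (submxMl _ _))// eq_row_base.
  exact: EX.
have vX : (v <= X)%MS.
  have EY : P (\rank (X + v)%MS).
    apply/asboolP; exists (X + v)%MS; split=> // x.
    have /sub_addsmxP[[y z] ->] : (x *m (X + v)%MS <= X + v)%MS by exact: submxMl.
    rewrite /= addrC (mx11_scalar z) mul_scalar_mx; apply: EL => //.
  have := rmax _ EY; rewrite -rX => le.
  have [_ e] := mxrank_leqif_sup (addsmxSl X v).
  rewrite (submx_trans (addsmxSr X v))// -e eqn_leq le andbT.
  exact: mxrankS (addsmxSl X v).
have /submxP[y ->] : (v <= row_base X)%MS by rewrite eq_row_base.
by exists y.
Qed.

Section NegativeNormalSpace.
Context {R : realType} (G : groupTopologicalType) (m : nat) (A : atlas R G m).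
Context (M : topologicalType) (n : nat) (B : atlas R M n) (act : G -> M -> M).
Hypotheses (HG : lie_group A) (HM : smooth_manifold B).
Hypothesis (Hact : smooth_action A B act).
Context (f : M -> R) (sf : smooth_function B f) (invf : invariant_function act f).
Context (g : M -> 'rV[R]_n -> 'rV[R]_n -> R).
Hypotheses (rg : riemannian_metric B g) (ig : invariant_metric B act g).

Let cB : charted B. Proof. exact: charted_smooth_manifold. Qed.
Let T a p v := tangent_map B B (act a) p v.
Let normal p := Defs.normal_space A B act g p.

(** The weak form of the eigenvalue equation, tested against normal vectors. Unlike the operator
    obtained by [xget], it is visibly linear in [u] and transported by isometries; [u = 0] is
    allowed. *)
Definition negative_eigenvector (l : R) p u := [/\ l < 0, normal p u &
  forall w, normal p w -> hessian B f p u w = l * g p u w].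

Lemma metric_linear p u : linear (g p u : 'rV[R]_n -> R^o).
Proof. by have [] := rg. Qed.

Lemma metric_sym p u v : g p u v = g p v u.
Proof. by have [] := rg. Qed.

Lemma metric_linear_l p u : linear (fun v => g p v u : R^o).
Proof. by move=> a x y; rewrite !(metric_sym p _ u) metric_linear. Qed.

Lemma metric_eq0 p v : g p v v = 0 -> v = 0.
Proof.
have [_ _ pos _] := rg => gv; apply/eqP/negPn/negP => /(pos p).
by rewrite gv ltxx.
Qed.

Lemma normal_space_linear p a u v : normal p u -> normal p v ->
  normal p (a *: u + v).
Proof.
move=> nu nv w ow; rewrite metric_linear_l nu// nv// addr0.
exact: mulr0.
Qed.

Lemma normal_space_act a p u : normal p u -> normal (act a p) (T a p u).
Proof.
move=> nu w ow; rewrite -[w](tangent_actVK HG HM Hact a p).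
rewrite ig; apply: nu.
by have := orbit_tangent_act HG HM Hact (a^-1)%g ow; rewrite (actK Hact).
Qed.

Lemma negative_eigenvector_act a l p u : critical_set B f (act a p) ->
  negative_eigenvector l p u -> negative_eigenvector l (act a p) (T a p u).
Proof.
move=> cr [l0 nu hu]; split; [exact: l0|exact: normal_space_act|].
move=> w nw; pose w' := T a^-1%g (act a p) w.
have wE : T a p w' = w by rewrite /w' /T (tangent_actVK HG HM Hact).
have nw' : normal p w'.
  by have := @normal_space_act a^-1%g _ _ nw; rewrite (actK Hact).
have hE := hessian_tangent_map HM sf u w' (smooth_act HG HM Hact a) (invf a) cr.
rewrite -wE; apply: (eq_trans hE); rewrite (hu _ nw'); congr (_ * _).
exact/esym/ig.
Qed.

Lemma hessian_operator_eigen l p u : l < 0 -> normal p u ->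
  hessian_operator A B act g f p u = l *: u <->
  forall w, normal p w -> hessian B f p u w = l * g p u w.
Proof.
move=> l0 nu; rewrite /hessian_operator.
set E := [set u' | _].
split=> [uE w nw|hu].
  have [[u' Eu']|nE] := pselect (E !=set0).
    have := xgetPex 0 (ex_intro _ u' Eu'); rewrite uE => -[_ /(_ w nw) ->].
    exact: linear_funZ (metric_linear_l p w).
  (* If no vector represents the Hessian, [xget] returns its default 0, and the equation 0 = l u
     with l < 0 leaves only u = 0. *)
  have u0 : u = 0.
    have : l *: u = 0 by rewrite -uE; apply: xgetPN => x Ex; apply: nE; exists x.
    by move=> /eqP; rewrite scaler_eq0 (lt_eqF l0) => /eqP.
  rewrite u0 (linear_fun0 (hessian_linear HM sf p w)).
  by rewrite (linear_fun0 (metric_linear_l p w)) mulr0.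
have gl w : g p (l *: u) w = l * g p u w.
  exact: linear_funZ (metric_linear_l p w).
have nlu : normal p (l *: u) by move=> w ow; rewrite gl nu// mulr0.
have Elu : E (l *: u) by split=> // w nw; rewrite gl hu.
have [nx hx] := xgetPex 0 (ex_intro _ _ Elu).
(* Uniqueness of the representing vector: x - l u is normal and orthogonal to every normal vector,
   itself included. *)
set x := xget 0 E in nx hx *; apply/subr0_eq/(metric_eq0 (p := p)).
have nd : normal p (x - l *: u).
  by rewrite addrC -scaleN1r; exact: normal_space_linear.
have gB w : g p (x - l *: u) w = g p x w - g p (l *: u) w.
  have := metric_linear_l p w (-1) (l *: u) x.
  by rewrite !scaleN1r [- _ + x]addrC => ->; rewrite addrC.
by rewrite gB gl -hu// -hx// subrr.
Qed.

Lemma negative_normal_spaceP p v : negative_normal_space A B act g f p v <->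
  exists2 s : seq 'rV[R]_n,
    (forall u, u \in s -> exists l, negative_eigenvector l p u) &
    v = \sum_(u <- s) u.
Proof.
split=> -[s sP vE]; exists s => // u /sP.
  move=> [nu [l l0 hu]]; exists l; split=> //.
  exact/(hessian_operator_eigen l0 nu).
by move=> [l [l0 nu hu]]; split=> //; exists l => //; exact/hessian_operator_eigen.
Qed.

Lemma negative_normal_space0 p : negative_normal_space A B act g f p 0.
Proof. by apply/negative_normal_spaceP; exists [::] => //; rewrite big_nil. Qed.

Lemma negative_eigenvector_scale l p a u :
  negative_eigenvector l p u -> negative_eigenvector l p (a *: u).
Proof.
move=> [l0 nu hu]; have gl w : g p (a *: u) w = a * g p u w.
  exact: linear_funZ (metric_linear_l p w).
split=> // [w ow|w nw]; first by rewrite gl nu// mulr0.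
apply: eq_trans (linear_funZ a u (hessian_linear HM sf p w)) _.
by rewrite hu// gl mulrCA.
Qed.

Lemma negative_normal_space_linear p a u v :
  negative_normal_space A B act g f p u ->
  negative_normal_space A B act g f p v ->
  negative_normal_space A B act g f p (a *: u + v).
Proof.
move=> /negative_normal_spaceP[s sP ->] /negative_normal_spaceP[t tP ->].
apply/negative_normal_spaceP; exists ([seq a *: x | x <- s] ++ t); last first.
  by rewrite big_cat big_map scaler_sumr.
move=> x; rewrite mem_cat => /orP[/mapP[y /sP[l ly] ->]|/tP//].
by exists l; exact: negative_eigenvector_scale.
Qed.

Lemma negative_normal_space_act a p v : critical_set B f (act a p) ->
  negative_normal_space A B act g f p v ->
  negative_normal_space A B act g f (act a p) (T a p v).
Proof.
move=> cr /negative_normal_spaceP[s sP ->].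
elim: s sP => [|u s IH] sP.
  rewrite big_nil /T (linear_fun0 (@tangent_map_linear _ _ _ _ _ B B (act a) p)).
  exact: negative_normal_space0.
rewrite big_cons -[u]scale1r /T tangent_map_linear.
apply: negative_normal_space_linear; last first.
  by apply: IH => x xs; apply: sP; rewrite in_cons xs orbT.
have [l ul] := sP u (mem_head _ _).
apply/negative_normal_spaceP; exists [:: T a p u]; last by rewrite big_seq1.
by move=> x; rewrite inE => /eqP ->; exists l; exact: negative_eigenvector_act.
Qed.

End NegativeNormalSpace.

(** * The stabilizer acts trivially on the negative normal space *)

Section StabilizerFixes.
Context {R : realType} (G : groupTopologicalType) (m : nat) (A : atlas R G m).
Context (M : topologicalType) (n : nat) (B : atlas R M n) (act : G -> M -> M).
Hypotheses (HG : lie_group A) (HM : smooth_manifold B).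
Hypothesis (Hact : smooth_action A B act) (Gcompact : compact [set: G]).
Context (f : M -> R) (sf : smooth_function B f) (invf : invariant_function act f).
Context (g : M -> 'rV[R]_n -> 'rV[R]_n -> R).
Hypotheses (rg : riemannian_metric B g) (ig : invariant_metric B act g).
Context (q : M) (crq : critical_set B f q).
Hypothesis (pdq : positive_definite_on_N'' A B act f q).

Let T a v := tangent_map B B (act a) q v.

Lemma stabilizer_fixes_eigenvector l u h :
  negative_eigenvector A B act f g l q u -> Defs.stabilizer act q h -> T h u = u.
Proof.
move=> eu Hh; have [mu haar pd] := pdq.
have [l0 nu hu] := eu; pose v := average B act mu q u.
(* [H] acts at q by isometries preserving the Hessian, so each eigenspace is stable; as it is cut
   out by linear equations, [avg0] puts the average [v] in it too. *)
have eT a : Defs.stabilizer act q a ->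
    negative_eigenvector A B act f g l q (T a u).
  move=> Ha; have cra : critical_set B f (act a q) by rewrite (Ha : act a q = q).
  have := negative_eigenvector_act HG HM Hact sf invf ig cra eu.
  by rewrite (Ha : act a q = q).
have avg0 (k : 'rV[R]_n -> R^o) : linear k ->
    (forall a, Defs.stabilizer act q a -> k (T a u) = 0) -> k v = 0.
  move=> lk k0; rewrite /v (average_linear HG HM Hact Gcompact q mu u lk).
  rewrite (@eq_Rintegral _ (borel G) R mu _ (fun=> 0)); last first.
    by move=> a; rewrite inE => /k0.
  rewrite Rintegral_cst ?mul0r//.
  exact: (stabilizer_measurable HG HM Hact).
have nv w : orbit_tangent A B act q w -> g q v w = 0.
  move=> ow; apply: (avg0 _ (metric_linear_l rg q w)).
  by move=> a Ha; have [_ na _] := eT a Ha; exact: na w ow.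
have hv w : Defs.normal_space A B act g q w -> hessian B f q v w = l * g q v w.
  move=> nw; apply/subr0_eq.
  apply: (avg0 (fun x => hessian B f q x w - l * g q x w)).
    move=> a x y; have -> := hessian_linear HM sf q w a x y.
    have -> := metric_linear_l rg q w a x y.
    rewrite /GRing.scale /=; ring.
  by move=> a Ha; have [_ _ ha] := eT a Ha; rewrite (ha w nw) subrr.
pose z := u - v.
have zE : z = (-1) *: v + u by rewrite scaleN1r addrC.
have nz : Defs.normal_space A B act g q z.
  by rewrite zE; apply: (normal_space_linear rg).
have hz : hessian B f q z z = l * g q z z.
  rewrite {1 3}zE.
  have -> := hessian_linear HM sf q z (-1) v u.
  have -> := metric_linear_l rg q z (-1) v u.
  by rewrite hv// hu// /GRing.scale /=; ring.
have Nz : N'' A B act mu q z.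
  rewrite /N'' /= (average_sub HG HM Hact Gcompact haar).
  exists 0 => //.
  exact: linear_fun0 (@tangent_map_linear _ _ _ _ _ A B (fun a => act a q) 1%g).
have z0 : z = 0.
  apply: contrapT => zn0.
  have gz : 0 < g q z z by have [_ _ pos _] := rg; apply: pos; apply/eqP.
  (* Positivity concerns nonzero classes modulo T_q(G.q); a normal vector tangent to the orbit would
     be orthogonal to itself. *)
  have noz : ~ orbit_tangent A B act q z.
    by move=> oz; move: gz; rewrite nz// ltxx.
  have := pd z Nz noz; rewrite hz pmulr_lgt0// => l1.
  by move: (lt_trans l0 l1); rewrite ltxx.
have -> : u = v by apply/subr0_eq.
exact: (tangent_average HG HM Hact Gcompact haar).
Qed.

Lemma stabilizer_fixes_negative v h :
  negative_normal_space A B act g f q v -> Defs.stabilizer act q h -> T h v = v.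
Proof.
move=> /(@negative_normal_spaceP _ _ _ A _ _ B act HM f sf g rg q v)[s sP ->] Hh.
elim: s sP => [|u s IH] sP.
  rewrite big_nil /T.
  exact: linear_fun0 (@tangent_map_linear _ _ _ _ _ B B (act h) q).
rewrite big_cons -[u]scale1r /T tangent_map_linear -/(T h _) -/(T h _).
have [l ul] := sP u (mem_head _ _).
rewrite (stabilizer_fixes_eigenvector ul Hh) IH// => x xs.
by apply: sP; rewrite in_cons xs orbT.
Qed.

End StabilizerFixes.

(** * The equivariant trivialization *)

Lemma smooth_preimage_open (R : realType) (V W : normedModType R) (U : set V)
    (D : set W) (s : V -> W) :
  open U -> open D -> smooth_on U s -> open (U `&` s @^-1` D).
Proof.
move=> oU oD ss; rewrite openE => x [Ux Dx]; apply: filterI.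
  exact: open_nbhs_nbhs.
have cs : {for x, continuous s}.
  exact/differentiable_continuous/(smooth_on_diff ss Ux).
exact: cs _ (open_nbhs_nbhs (conj oD Dx)).
Qed.

Theorem lemma4p2 (R : realType)
  (G : groupTopologicalType) (m : nat) (A : atlas R G m)
  (M : topologicalType) (n : nat) (B : atlas R M n)
  (act : G -> M -> M) (f : M -> R)
  (HG : lie_group A) (Gcompact : compact [set: G])
  (HM : smooth_manifold B) (Mcompact : compact [set: M])
  (Hact : smooth_action A B act)
  (fGMB : G_morse_bott A B act f) (fstable : stable A B act f) :
  forall S : set M, critical_orbit B act f S ->
  forall g : M -> 'rV[R]_n -> 'rV[R]_n -> R,
    riemannian_metric B g -> invariant_metric B act g ->
    trivial_vector_bundle B S (negative_normal_space A B act g f).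
Proof.
move=> S [Scr [p Sp]] g rg ig.
have [sf invf _ _] := fGMB.
have cA : charted A by have [/charted_smooth_manifold] := HG.
have cB : charted B by exact: charted_smooth_manifold.
have pS : S p by rewrite Sp; exists 1%g; rewrite ?(act1 Hact).
have [q Cq pdq] := fstable p (Scr _ pS).
have qS : S q.
  by rewrite Sp; apply: (component_sub_orbit HG HM Hact Gcompact fGMB _ Cq);
    rewrite -Sp.
have SE s : S s -> Defs.orbit act s = S.
  by rewrite Sp => -[a _ <-]; rewrite (orbit_act Hact).
pose T a v := tangent_map B B (act a) q v.
pose NS := negative_normal_space A B act g f.
have [k [X [Xfree XE]]] : exists k (X : 'M[R]_(k, n)),
    row_free X /\ range (mulmx ^~ X) = NS q.
  apply: linear_set_row_space; first exact: negative_normal_space0.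
  by move=> a u v; exact: negative_normal_space_linear.
have NX x : NS q (x *m X) by rewrite -XE; exists x.
(* An arbitrary choice of a group element over each point of [S]; the default 1 is met only off
   [S]. *)
pose el s : G := xget 1%g [set a | act a q = s].
have elP s : S s -> act (el s) q = s.
  rewrite -(SE q qS) => -[a _ aq].
  have aP : exists b, [set b | act b q = s] b by exists a.
  exact: (xgetPex 1%g aP).
pose Phi s x := T (el s) (x *m X).
(* Independence of the choice: [b] and the chosen element differ by an element of the stabilizer,
   which fixes [x *m X]. *)
have PhiE b x : Phi (act b q) x = T b (x *m X).
  have Sb : S (act b q) by rewrite -(SE q qS); exists b.
  pose h := ((el (act b q))^-1 * b)%g.
  have Hh : Defs.stabilizer act q h.
    by rewrite /Defs.stabilizer /= /h (actM Hact) -{2}(elP _ Sb) (actK Hact).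
  have bE : b = (el (act b q) * h)%g by rewrite /h mulVKg.
  have Tfix : T h (x *m X) = x *m X.
    exact: (stabilizer_fixes_negative HG HM Hact Gcompact sf invf rg ig
      (Scr _ qS) pdq (NX x) Hh).
  have := tangent_act_mul HG HM Hact (el (act b q)) h q (x *m X).
  rewrite -bE (Hh : act h q = q) => E.
  exact: esym (eq_trans E (congr1 (T (el (act b q))) Tfix)).
exists k, Phi; split=> [s Ss|x s0 Ss0].
  have sE := elP s Ss; set a := el s in sE.
  have NT v : NS q v -> NS s (T a v).
    have cra : critical_set B f (act a q) by rewrite sE; exact: Scr.
    move=> Nv.
    have := negative_normal_space_act HG HM Hact sf invf rg ig cra Nv.
    by rewrite sE.
  have NV w : NS s w -> exists2 v, NS q v & T a v = w.
    have VE : act a^-1%g s = q by rewrite -sE (actK Hact).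
    have cra : critical_set B f (act a^-1%g s) by rewrite VE; exact: Scr.
    move=> Nw; exists (tangent_map B B (act a^-1%g) s w).
      have := negative_normal_space_act HG HM Hact sf invf rg ig cra Nw.
      by rewrite VE.
    by have := tangent_actVK HG HM Hact a q w; rewrite sE.
  split.
  - by move=> c x y; rewrite /Phi mulmxDl -scalemxAl /T tangent_map_linear.
  - move=> x y; rewrite /Phi -/a => /(congr1 (tangent_map B B (act a^-1%g) (act a q))).
    rewrite /T !(tangent_actK HG HM Hact).
    exact: (row_free_inj Xfree).
  - apply/seteqP; split=> [_ [x _ <-]|w /NV[v Nv <-]]; first exact/NT/NX.
    by move: Nv; rewrite -XE => -[x _ <-]; exists x.
have crs : Defs.orbit act s0 `<=` critical_set B f by rewrite SE.
have [V [sg [oV Vs0 ssg sgA sgP]]] := local_section HG HM Hact fGMB crs.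
have [W [oW Ws0 WC]] := orbit_near_component HG HM Hact Gcompact crs.
have [hB s00] := cB s0; have [oB _ BK _ _] := hB.
have [[oA _ AK _ _] d1] := cA 1%g.
have Cs0 : connected_component (critical_set B f) s0 s0.
  exact/connected_component_refl/Scr.
have [_ _ sF] := Hact; pose F (z : G * M) := act z.1 z.2.
pose at1 := prod_atlas A B (1%g, s0).
pose J := B s0 \o F \o param at1.
pose D := at1 @` (dom at1 `&` F @^-1` dom (B s0)).
have oD : open D by exact: (joint_open cA cB cB sF).
have sJ : smooth_on D J by have [_] := sF; exact.
pose v0 := Phi s0 x.
pose io z := row_mx (sg z) (B s0 s0).
have sio : smooth_on V io.
  move=> j; apply: (k_differentiable_comp (f := sg)
    (g := fun u => row_mx u (B s0 s0)) oV openT) => //.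
  exact: smooth_row_mxl openT j.
pose U := (V `&` io @^-1` D) `&` B s0 @` (dom (B s0) `&` W).
have oVD : open (V `&` io @^-1` D) by exact: smooth_preimage_open.
have oU : open U by apply: openI => //; exact: chart_image_open.
have UV : U `<=` V by move=> z [[]].
have ioP s : S s -> dom (B s0) s -> W s -> V (B s0 s) -> exists a,
    [/\ dom (A 1%g) a, sg (B s0 s) = A 1%g a & act a s0 = s].
  move=> Ss Bs Ws Vs; have [a da aE] := sgA _ Vs.
  exists a; split=> //; have <- := sgP s _ Bs Vs.
    by rewrite -aE AK ?inE.
  by apply: WC; split=> //; rewrite SE.
(* At z = B s0 s this is d(a)_s0 v0 read in the chart at [s0], where a is the group element given by
   the section, with a.s0 = s. The formula still makes sense and is smooth for z off the orbit. *)
exists U, (fun z => 'D_(row_mx 0 v0) J (io z)); split=> //.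
- split; last by exists s0.
  split=> //; have [a [da aE as0]] := ioP s0 Ss0 s00 Ws0 Vs0.
  rewrite /io /= aE; exists (a, s0) => //; split=> //.
  by rewrite /F /= as0.
- move=> j; apply: (k_differentiable_comp (f := io) (g := 'D_(row_mx 0 v0) J)
    oU oD); first by move=> z [[]].
    exact: k_differentiable_subset UV (sio j).
  exact: smooth_on_derive sJ j.
move=> s Ss Bs [[Vs _] [s' [Bs' Ws'] s'E]].
have Ws : W s by rewrite -(BK s) ?inE// -s'E BK ?inE.
have [a [da aE as0]] := ioP s Ss Bs Ws Vs.
have bE : act (a * el s0)%g q = s by rewrite (actM Hact) (elP _ Ss0).
(* By [PhiE] the element chosen over s may be replaced by a [el s0]; the arbitrary choice then
   enters only through the constant [el s0]. *)
have PhisE : Phi s x = tangent_map B B (act a) s0 v0.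
  rewrite -{1}bE PhiE; have := tangent_act_mul HG HM Hact a (el s0) q (x *m X).
  by rewrite (elP _ Ss0).
have [hs ss] := cB s.
have sa := smooth_act HG HM Hact a; have [ca _] := sa.
have das : dom (B s) (act a s0) by rewrite as0.
have n1 := near_chart_map cB ca (let: And5 o _ _ _ _ := hs in o) s00 das.
have d2 := smooth_map_diff sa s00 das.
have ps0 : param (B s0) (B s0 s0) = s0 by rewrite BK ?inE.
have d3 : differentiable (B s0 \o param (B s)) (B s (act a s0)).
  by rewrite as0; apply: chart_change_diff.
have := @diff_through_chart _ _ _ _ _ (B s) (act a \o param (B s0)) (B s0)
  (B s0 s0) v0 hs n1 d2.
rewrite /= ps0 => /(_ d3) E.
have qa : dom (B s0) (F (a, s0)) by rewrite /F /= as0.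
have E2 := diff_partial_r cA cB sF v0 da qa.
rewrite PhisE /chart_change /tangent_map as0.
rewrite as0 in E; apply: (eq_trans (esym E)).
by apply: (eq_trans E2); rewrite /io aE.
Qed.
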